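(* Let $q$ be an odd prime. Let $\widetilde{\mathcal N}(2q)$ be the number of (centrally) nilpotent loops of order $2q$ counted up to isotopism, and let $\mathcal N(2q)$ be the number of nilpotent loops of order $2q$ counted up to isomorphism. Then \begin{align*} \widetilde{\mathcal N}(2q) ={}& \frac{2^{(q-2)(q-1)}}{q^2(q-1)}+\frac{1}{q-1}\sum_{\emptyset\neq D\subseteq \mathrm{Pred}(q-1)}(-1)^{|D|}2^{(q-2)\gcd(D)}\\ &+\sum_{d\mid q-1,\ 1\le d<q-1}\frac1d\Bigg(2^{(q-2)d}+\sum_{\emptyset\neq D\subseteq \mathrm{Pred}(d)}(-1)^{|D|}2^{(q-2)\gcd(D)}\Bigg)\\ &+\frac{1}{q^2}\Big((q-2)2^{q-1}+3\Big)\\ ={}&\mathcal N(2q)+\frac{1}{q^2}\Big(-(q+1)2^{(q-2)(q-1)}+(q-2)2^{q-1}+3\Big). \end{align*}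
   Context: A loop is a set $Q$ with a binary operation having a two-sided neutral element and such that for all $a,b\in Q$ the equations $a\cdot x=b$ and $y\cdot a=b$ have unique solutions $x,y$. The center $Z(Q)$ is the set of $x\in Q$ with $xy=yx$, $(xy)z=x(yz)$, $(yx)z=y(xz)$, $(yz)x=y(zx)$ for all $y,z\in Q$; it is a normal subloop (normal subloops are kernels of loop homomorphisms). The upper central series is given by $Z_0(Q)=1$ and $Z_{i+1}(Q)$ the preimage in $Q$ of $Z(Q/Z_i(Q))$. $Q$ is (centrally) nilpotent if $Z_n(Q)=Q$ for some $n$. Two loops $(L_1,\cdot)$, $(L_2,\ast)$ are isotopic if there are bijections $\alpha,\beta,\gamma:L_1\to L_2$ with $\alpha(x)\ast\beta(y)=\gamma(x\cdot y)$ for all $x,y\in L_1$; such a triple is an isotopism. Counting ''up to isotopism'' (resp. ''up to isomorphism'') means counting isotopy (resp. isomorphism) classes. For a positive integer $d$, $\mathrm{Pred}(d)=\{d' : 1\le d'<d,\ d' \text{ divides } d,\ d/d' \text{ is a prime}\}$. For a nonempty finite set $D$ of positive integers, $\gcd(D)$ is the greatest common divisor of its elements. *)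

(* Defs.v *)
From mathcomp Require Import all_boot all_order all_algebra.
From mathcomp Require Import boolp classical_sets.

Set Implicit Arguments.
Unset Strict Implicit.
Unset Printing Implicit Defensive.

Local Open Scope classical_set_scope.

Definition neutral (T : Type) (op : T -> T -> T) (e : T) : Prop :=
  forall x, op e x = x /\ op x e = x.

Definition is_loop (T : Type) (op : T -> T -> T) : Prop :=
  [/\ exists e, neutral op e,
      forall a b, exists! x, op a x = b
    & forall a b, exists! y, op y a = b].

Definition loop_center (T : Type) (op : T -> T -> T) : set T :=
  [set x | forall y z,
    [/\ op x y = op y x,
        op (op x y) z = op x (op y z),
        op (op y x) z = op y (op x z)
      & op (op y z) x = op y (op z x)]].

Definition loop_coset (T : Type) (op : T -> T -> T) (N : set T) (x : T) :
  set T := [set op x n | n in N].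

(* The carrier of the quotient by N is the set of cosets xN. The product of
   two cosets is computed on chosen representatives; for N a normal subloop
   the choice is irrelevant and the quotient is a loop (loop_quo_mulE and
   loop_quo_loop below). *)
Definition loop_quo (T : Type) (op : T -> T -> T) (N : set T) : Type :=
  {A : set T | exists x, A = loop_coset op N x}.

Definition loop_proj (T : Type) (op : T -> T -> T) (N : set T) (x : T) :
  loop_quo op N := exist _ (loop_coset op N x) (ex_intro _ x erefl).

Definition loop_repr (T : Type) (op : T -> T -> T) (N : set T)
  (A : loop_quo op N) : T := sval (cid (svalP A)).

Definition loop_quo_mul (T : Type) (op : T -> T -> T) (N : set T)
    (A B : loop_quo op N) : loop_quo op N :=
  loop_proj op N (op (loop_repr A) (loop_repr B)).

(* Each term of the series is a normal subloop (upper_central_normal below),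
   so the quotients taken here are genuine quotient loops. *)
Fixpoint upper_central (T : Type) (op : T -> T -> T) (i : nat) : set T :=
  if i is j.+1 then
    let N := upper_central op j in
    [set x | loop_center (@loop_quo_mul T op N) (loop_proj op N x)]
  else [set e | neutral op e].

Definition loop_nilpotent (T : Type) (op : T -> T -> T) : Prop :=
  exists n, upper_central op n = setT.

Definition isotopic (T1 T2 : Type) (op1 : T1 -> T1 -> T1)
    (op2 : T2 -> T2 -> T2) : Prop :=
  exists a b c : T1 -> T2,
    [/\ bijective a, bijective b, bijective c
      & forall x y, op2 (a x) (b y) = c (op1 x y)].

Definition loop_isomorphic (T1 T2 : Type) (op1 : T1 -> T1 -> T1)
    (op2 : T2 -> T2 -> T2) : Prop :=
  exists2 f : T1 -> T2, bijective f
    & forall x y, f (op1 x y) = op2 (f x) (f y).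

(* Every loop of order n is isomorphic to one carried by 'I_n, so classes of
   loops of order n are counted among multiplication tables on 'I_n. *)
Definition mul_table (n : nat) := {ffun 'I_n * 'I_n -> 'I_n}.

Definition table_op (n : nat) (t : mul_table n) : 'I_n -> 'I_n -> 'I_n :=
  fun x y => t (x, y).

Definition nilpotent_loops (n : nat) : {set mul_table n} :=
  finset (fun t : mul_table n =>
    `[< is_loop (table_op t) /\ loop_nilpotent (table_op t) >]).

Definition num_nilpotent_isotopy (n : nat) : nat :=
  #|equivalence_partition
      (fun s t : mul_table n => `[< isotopic (table_op s) (table_op t) >])
      (nilpotent_loops n)|.

Definition num_nilpotent_iso (n : nat) : nat :=
  #|equivalence_partition
      (fun s t : mul_table n =>
         `[< loop_isomorphic (table_op s) (table_op t) >])
      (nilpotent_loops n)|.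

(* Elements of 'I_d carry the bound d' < d. *)
Definition Pred (d : nat) : {set 'I_d} :=
  finset (fun d' : 'I_d => [&& 0 < d', d' %| d & prime (d %/ d')]).

Definition gcd_set (d : nat) (D : {set 'I_d}) : nat :=
  \big[gcdn/0]_(i in D) (i : nat).

Lemma isotopic_refl (T : Type) (op : T -> T -> T) : isotopic op op.
Proof. by exists id, id, id; split=> //; exists id. Qed.

Lemma isotopic_sym (T1 T2 : Type) (op1 : T1 -> T1 -> T1)
    (op2 : T2 -> T2 -> T2) : isotopic op1 op2 -> isotopic op2 op1.
Proof.
move=> [a [b [c [[a' aK aK'] [b' bK bK'] [c' cK cK'] h]]]].
exists a', b', c'; split; [by exists a | by exists b | by exists c |].
by move=> x y; rewrite -[op1 _ _]cK -h aK' bK'.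
Qed.

Lemma isotopic_trans (T1 T2 T3 : Type) (op1 : T1 -> T1 -> T1)
    (op2 : T2 -> T2 -> T2) (op3 : T3 -> T3 -> T3) :
  isotopic op1 op2 -> isotopic op2 op3 -> isotopic op1 op3.
Proof.
move=> [a [b [c [ba bb bc h]]]] [a' [b' [c' [ba' bb' bc' h']]]].
exists (a' \o a), (b' \o b), (c' \o c).
by split=> [||| x y /=]; [exact: bij_comp .. | rewrite h' h].
Qed.

Lemma loop_isomorphic_refl (T : Type) (op : T -> T -> T) :
  loop_isomorphic op op.
Proof. by exists id => //; exists id. Qed.

Lemma loop_isomorphic_sym (T1 T2 : Type) (op1 : T1 -> T1 -> T1)
    (op2 : T2 -> T2 -> T2) : loop_isomorphic op1 op2 -> loop_isomorphic op2 op1.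
Proof.
move=> [f [g fK gK] h]; exists g; first by exists f.
by move=> x y; rewrite -[op1 _ _]fK h !gK.
Qed.

Lemma loop_isomorphic_trans (T1 T2 T3 : Type) (op1 : T1 -> T1 -> T1)
    (op2 : T2 -> T2 -> T2) (op3 : T3 -> T3 -> T3) :
  loop_isomorphic op1 op2 -> loop_isomorphic op2 op3 ->
  loop_isomorphic op1 op3.
Proof.
move=> [f bf h] [g bg h']; exists (g \o f); first exact: bij_comp.
by move=> x y /=; rewrite h h'.
Qed.

Definition normal_subloop (T : Type) (op : T -> T -> T) (N : set T) : Prop :=
  exists (T' : Type) (op' : T' -> T' -> T') (f : T -> T'),
    [/\ is_loop op', forall x y, f (op x y) = op' (f x) (f y)
      & N = [set x | neutral op' (f x)]].

Lemma loop_cancell (T : Type) (op : T -> T -> T) (L : is_loop op) a x y :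
  op a x = op a y -> x = y.
Proof.
by case: L => _ h _ e; case: (h a (op a y)) => z [_ zu];
  rewrite -(zu x) // -(zu y).
Qed.

Lemma loop_cancelr (T : Type) (op : T -> T -> T) (L : is_loop op) a x y :
  op x a = op y a -> x = y.
Proof.
by case: L => _ _ h e; case: (h a (op y a)) => z [_ zu];
  rewrite -(zu x) // -(zu y).
Qed.

Lemma loop_divl (T : Type) (op : T -> T -> T) (L : is_loop op) a b :
  exists x, op a x = b.
Proof. by case: L => _ h _; case: (h a b) => z [zP _]; exists z. Qed.

Lemma loop_divr (T : Type) (op : T -> T -> T) (L : is_loop op) a b :
  exists y, op y a = b.
Proof. by case: L => _ _ h; case: (h a b) => z [zP _]; exists z. Qed.

Lemma neutral_unitl (T : Type) (op : T -> T -> T) (a u : T) :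
  is_loop op -> op a u = a -> neutral op u.
Proof.
move=> L au; have [[e en] _ _] := L.
by rewrite (_ : u = e) //; apply: (loop_cancell L (a := a)); rewrite au (en a).2.
Qed.

Lemma loop_projP (T : Type) (op : T -> T -> T) (N : set T) x y :
  loop_proj op N x = loop_proj op N y <->
  loop_coset op N x = loop_coset op N y.
Proof. by split=> [/(congr1 sval)//|e]; apply: eq_sig_hprop. Qed.

Lemma loop_reprK (T : Type) (op : T -> T -> T) (N : set T)
  (A : loop_quo op N) : loop_proj op N (loop_repr A) = A.
Proof.
by apply: eq_sig_hprop => //=; rewrite /loop_repr; case: cid.
Qed.

Definition coset_congruence (T : Type) (op : T -> T -> T) (N : set T) : Prop :=
  let R x y := loop_coset op N x = loop_coset op N y in
  [/\ forall x x' y y', R x x' -> R y y' -> R (op x y) (op x' y'),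
      forall a x y, R (op a x) (op a y) -> R x y
    & forall a x y, R (op x a) (op y a) -> R x y].

Lemma congruence_quo_mulE (T : Type) (op : T -> T -> T) (N : set T) :
  coset_congruence op N ->
  forall x y, loop_quo_mul (loop_proj op N x) (loop_proj op N y)
            = loop_proj op N (op x y).
Proof.
by move=> [c _ _] x y; apply/loop_projP/c; apply/loop_projP;
  rewrite loop_reprK.
Qed.

Lemma congruence_quo_loop (T : Type) (op : T -> T -> T) (N : set T) :
  is_loop op -> coset_congruence op N -> is_loop (@loop_quo_mul T op N).
Proof.
move=> L cN; have mE := congruence_quo_mulE cN.
case: cN => [_ cl cr]; split.
- have [[e en] _ _] := L; exists (loop_proj op N e) => A.
  by rewrite -[A]loop_reprK !mE (en _).1 (en _).2.
- move=> A B; rewrite -[A]loop_reprK -[B]loop_reprK.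
  move: (loop_repr A) (loop_repr B) => a b.
  have [x xE] := loop_divl L a b.
  exists (loop_proj op N x); split; first by rewrite mE xE.
  move=> C; rewrite -[C]loop_reprK mE => /loop_projP h.
  by apply/loop_projP/(cl a); rewrite h xE.
- move=> A B; rewrite -[A]loop_reprK -[B]loop_reprK.
  move: (loop_repr A) (loop_repr B) => a b.
  have [x xE] := loop_divr L a b.
  exists (loop_proj op N x); split; first by rewrite mE xE.
  move=> C; rewrite -[C]loop_reprK mE => /loop_projP h.
  by apply/loop_projP/(cr a); rewrite h xE.
Qed.

Lemma normal_coset_eq (T : Type) (op : T -> T -> T) (N : set T)
    (T' : Type) (op' : T' -> T' -> T') (f : T -> T') :
  is_loop op -> is_loop op' -> (forall x y, f (op x y) = op' (f x) (f y)) ->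
  N = [set x | neutral op' (f x)] ->
  forall x y, loop_coset op N x = loop_coset op N y <-> f x = f y.
Proof.
move=> L L' fM NE x y.
have sub u v : f u = f v -> loop_coset op N u `<=` loop_coset op N v.
  move=> uv z [n Nn <-]; have [m mE] := loop_divl L v (op u n).
  exists m => //; rewrite NE /=; apply: (neutral_unitl (a := f v) L').
  rewrite -fM mE fM uv; move: Nn; rewrite NE => /= nn; exact: (nn _).2.
split=> [xy|xy]; last by apply/seteqP; split; apply: sub.
have [[e en] _ _] := L.
have Ne : N e.
  by rewrite NE /=; apply: (neutral_unitl (a := f e) L'); rewrite -fM (en e).1.
have : loop_coset op N y x by rewrite -xy; exists e => //; rewrite (en x).2.
by case=> n; rewrite NE /= => nn <-; rewrite fM (nn _).2.
Qed.

Lemma normal_congruence (T : Type) (op : T -> T -> T) (N : set T) :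
  is_loop op -> normal_subloop op N -> coset_congruence op N.
Proof.
move=> L [T' [op' [f [L' fM NE]]]].
have cE := normal_coset_eq L L' fM NE; split.
- by move=> x x' y y' /cE ex /cE ey; apply/cE; rewrite !fM ex ey.
- move=> a x y /cE; rewrite !fM => h; apply/cE; exact: (loop_cancell L' h).
- move=> a x y /cE; rewrite !fM => h; apply/cE; exact: (loop_cancelr L' h).
Qed.

Lemma loop_quo_mulE (T : Type) (op : T -> T -> T) (N : set T) :
  is_loop op -> normal_subloop op N ->
  forall x y, loop_quo_mul (loop_proj op N x) (loop_proj op N y)
            = loop_proj op N (op x y).
Proof. by move=> L nN; apply/congruence_quo_mulE/normal_congruence. Qed.

Lemma loop_quo_loop (T : Type) (op : T -> T -> T) (N : set T) :
  is_loop op -> normal_subloop op N -> is_loop (@loop_quo_mul T op N).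
Proof. by move=> L nN; apply/congruence_quo_loop/normal_congruence. Qed.

Lemma loop_center_normal (T : Type) (op : T -> T -> T) :
  is_loop op -> normal_subloop op (loop_center op).
Proof.
move=> L; have [[e en] _ _] := L; set C := loop_center op.
have mC c : C c -> forall y z, [/\ op c y = op y c,
    op (op c y) z = op c (op y z), op (op y c) z = op y (op c z)
  & op (op y z) c = op y (op z c)] by [].
have CI c : (forall y z, [/\ op c y = op y c, op (op c y) z = op c (op y z)
    & op (op y c) z = op y (op c z)]) -> C c.
  move=> h y z; have [h1 h2 h3] := h y z; split=> //.
  by have [<- _ _] := h (op y z) y; have [<- _ _] := h z y; rewrite -h3 -h1 h2.
have Ce : C e.
  by apply: CI => y z; rewrite !(en _).1 !(en _).2.
have cC c y : C c -> op c y = op y c by move=> /mC/(_ y y)[].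
have c1 c y z : C c -> op (op c y) z = op c (op y z) by move=> /mC/(_ y z)[].
have c2 c y z : C c -> op (op y c) z = op y (op c z) by move=> /mC/(_ y z)[].
have c3 c y z : C c -> op (op y z) c = op y (op z c) by move=> /mC/(_ y z)[].
have CM c d : C c -> C d -> C (op c d).
  move=> Cc Cd.
  have k1 y : op (op c d) y = op y (op c d).
    by rewrite (c1 c d y) // (cC d y) // -(c1 c y d) // (cC c y) // c2.
  have k2 y z : op (op (op c d) y) z = op (op c d) (op y z).
    by rewrite (c1 c d y) // (c1 c _ z) // (c1 d y z) // (c1 c d).
  apply: CI => y z; split=> //; rewrite -k1 k2 (c1 c d _) // (c1 c d z) //.
  rewrite -(c2 c y _) // -(cC c y) // (c1 c y) // -(c2 d y z) // -(cC d y) //.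
  by rewrite (c1 d y z).
have CV c : C c -> exists2 d, C d & op c d = e.
  move=> Cc; have [d cd] := loop_divl L c e; exists d => //.
  have j y : op c (op d y) = y by rewrite -c1 // cd (en _).1.
  have j' y : op c (op y d) = y by rewrite -c1 // (cC c) // c2 // cd (en _).2.
  apply: CI => y z; split; apply: (loop_cancell L (a := c)).
  - by rewrite j j'.
  - by rewrite -c1 // !j.
  - by rewrite -c1 // j' -c1 // (cC c) // c2 // j.
have cE x y : loop_coset op C x = loop_coset op C y <->
    exists2 c, C c & y = op x c.
  have sub u c : C c -> loop_coset op C (op u c) `<=` loop_coset op C u.
    by move=> Cc _ [n Cn <-]; exists (op c n); [exact: CM | rewrite c2].
  split=> [xy|[c Cc ->]].
    have : loop_coset op C x y by rewrite xy; exists e => //; rewrite (en y).2.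
    by case=> c Cc <-; exists c.
  apply/seteqP; split; last exact: sub.
  have [d Cd cd] := CV c Cc.
  by rewrite [in X in X `<=` _](_ : x = op (op x c) d);
    [exact: sub | rewrite c2 // cd (en _).2].
have cong : coset_congruence op C.
  split.
  - move=> x x' y y' /cE[c Cc ->] /cE[d Cd ->]; apply/cE.
    exists (op c d); first exact: CM.
    by rewrite -(c3 d (op x c) y) // (c2 c x y) // (cC c y) //
      -(c3 c x y) // (c3 d).
  - move=> a x y /cE[c Cc h]; apply/cE; exists c => //.
    by apply: (loop_cancell L (a := a)); rewrite h c3.
  - move=> a x y /cE[c Cc h]; apply/cE; exists c => //.
    by apply: (loop_cancelr L (a := a)); rewrite h c3 // -(cC c a) // c2.
have QL := congruence_quo_loop L cong.
have mE := congruence_quo_mulE cong.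
exists (loop_quo op C), (@loop_quo_mul T op C), (loop_proj op C).
split=> //; apply/seteqP; split=> x /=.
- move=> Cx; apply: (neutral_unitl (a := loop_proj op C e) QL).
  rewrite mE; apply/esym/loop_projP/cE; exists x => //.
- move=> nx; have := (nx (loop_proj op C e)).2; rewrite mE (en x).1.
  move=> /esym/loop_projP/cE[c Cc]; by rewrite (en c).1 => ->.
Qed.

Lemma upper_central_normal (T : Type) (op : T -> T -> T) (i : nat) :
  is_loop op -> normal_subloop op (upper_central op i).
Proof.
move=> L; elim: i => [|i IH]; first by exists T, op, id.
have QL := loop_quo_loop L IH.
have mE := loop_quo_mulE L IH.
have [T' [op' [f [L' fM NE]]]] := loop_center_normal QL.
exists T', op', (f \o loop_proj op (upper_central op i)); split=> //.
- by move=> x y /=; rewrite -mE fM.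
- by rewrite /= NE.
Qed.

(* Main.v *)
Require Import Defs.
From HB Require Import structures.
From mathcomp Require Import all_boot all_order all_fingroup all_algebra all_solvable.
From mathcomp Require Import boolp zify ring.
Set Implicit Arguments.
Unset Strict Implicit.
Unset Printing Implicit Defensive.
Import GRing.Theory Num.Theory.
Local Open Scope ring_scope.

(** A nilpotent loop of order 2q is a central extension of Z/q by Z/2, hence is
    given on Z/2 x F_q by (a, x)(b, y) = (a + b + f(x, y), x + y). An isotopism
    commutes with translation by the central involution, so it is affine on F_q:
    isotopy of f and g means that g(ux + s, uy + t) - f(x, y) has the form
    a(x) + b(y) + c(x + y), and isomorphism is the case s = t = 0. Modulo such
    functions every f has a unique representative vanishing for x = 0, y = 0 and
    x = y; the diagonal can be cleared because (x, x) |-> 2a(x) - a(2x) = -a(2x)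
    in characteristic 2. Isomorphism classes are thus orbits of F_q^* permuting
    the pairs of distinct nonzero elements, and isotopy classes are orbits of the
    group of maps (x, y) |-> (ux + s, uy + t), both counted by Burnside's lemma:
    u <> 1 of order m fixes 2^((q-2)(q-1)/m) classes, and a translation by
    (s, t) <> 0 fixes a single class if s, t or s + t is 0 and 2^(q-1) classes
    otherwise. *)

(** * Divisor sums and alternating sums over maximal proper divisors *)

(** Adding or removing a fixed element [a] of [A] pairs off the subsets with opposite signs, so
    everything cancels unless [A] is empty. *)
Lemma sum_signed_subsets (T : finType) (A : {set T}) :
  \sum_(D : {set T} | D \subset A) (-1) ^+ #|D| = (A == set0)%:R :> rat.
Proof.
have [->|[a aA]] := set_0Vmem A.
  rewrite (big_pred1 set0) ?cards0 ?eqxx // => D.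
  by rewrite subset0.
have -> : (A == set0) = false by apply/negP => /eqP A0; rewrite A0 inE in aA.
rewrite (bigID (fun D : {set T} => a \in D)) /=.
rewrite (reindex_onto (fun D => a |: D) (fun D => D :\ a)) /=; last first.
  by move=> D /andP[_ aD]; rewrite setD1K.
rewrite -[X in X + _]opprK -sumrN.
rewrite [X in - X + _](_ : _ =
  \sum_(D : {set T} | (D \subset A) && (a \notin D)) (-1) ^+ #|D|) ?addNr //.
apply: eq_big => D.
  rewrite setU11 andbT subUset sub1set aA /=; congr (_ && _).
  apply/eqP/idP => [<-|aD]; first by rewrite !inE eqxx.
  by apply/setP => x; rewrite !inE; case: eqP => //= ->; rewrite (negbTE aD).
move=> /andP[_ /eqP DE]; have aD : a \notin D by rewrite -DE !inE eqxx.
by rewrite cardsU1 aD add1n exprS mulN1r opprK.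
Qed.

(** Möbius inversion in existential form: [G] is built recursively, its value at N + 1 being what
    the proper divisors leave over. The bound [N] is what the induction runs on. *)
Lemma divisor_sum_inverse (f : nat -> rat) N :
  exists G : nat -> rat, forall m, (0 < m <= N)%N ->
    f m = \sum_(1 <= e < m.+1 | (e %| m)%N) G e.
Proof.
elim: N => [|N [G GP]]; first by exists f => m; lia.
exists (fun m => if m == N.+1 then
  f N.+1 - \sum_(1 <= e < N.+1 | (e %| N.+1)%N) G e else G m) => m /andP[m0].
rewrite leq_eqVlt => /orP[/eqP ->|mN]; last first.
  rewrite GP ?m0 // big_nat_cond [RHS]big_nat_cond; apply: eq_bigr => e /andP[he _].
  by rewrite (_ : (e == N.+1) = false) //; lia.
rewrite big_mkcond big_nat_recr //= dvdnn eqxx -big_mkcond /= addrC.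
rewrite [X in _ - _ + X](_ : _ = \sum_(1 <= e < N.+1 | (e %| N.+1)%N) G e) ?subrK //.
rewrite big_nat_cond [RHS]big_nat_cond; apply: eq_bigr => e /andP[he _].
by rewrite (_ : (e == N.+1) = false) //; lia.
Qed.

(** For empty [D] the gcd is the default 0, which every [e] divides, in accordance with the vacuous
    right-hand side. *)
Lemma gcd_setP d (D : {set 'I_d}) e :
  (e %| gcd_set D)%N = [forall i in D, e %| i]%N.
Proof.
apply/idP/forall_inP => [eD i iD|h].
  by apply: dvdn_trans eD _; rewrite /gcd_set (bigD1 i) //= dvdn_gcdl.
by rewrite /gcd_set; elim/big_ind: _ => [|x y ex ey|//]; rewrite ?dvdn0 ?dvdn_gcd ?ex.
Qed.

(* An alternating sum over sets of maximal proper divisors inverts divisor sums: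
   the coefficient of G e is the alternating sum over subsets of those maximal
   proper divisors of d that e divides, which is empty only for e = d. *)
Lemma Pred_inversion (f G : nat -> rat) N :
  (forall m, (0 < m <= N)%N -> f m = \sum_(1 <= e < m.+1 | (e %| m)%N) G e) ->
  forall d, (0 < d <= N)%N ->
  f d + \sum_(D : {set 'I_d} | (D != set0) && (D \subset Pred d))
          (-1) ^+ #|D| * f (gcd_set D) = G d.
Proof.
move=> fE d /andP[d0 dN].
pose A e : {set 'I_d} := [set i in Pred d | (e %| i)%N].
have subA (D : {set _}) e : (D \subset A e) = (D \subset Pred d) && (e %| gcd_set D)%N.
  rewrite gcd_setP; apply/subsetP/andP => [h|[/subsetP h1 /forall_inP h2] i iD].
    split; first by apply/subsetP => i /h; rewrite inE => /andP[].
    by apply/forall_inP => i /h; rewrite inE => /andP[].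
  by rewrite inE h1 // h2.
have -> : f d + \sum_(D : {set 'I_d} | (D != set0) && (D \subset Pred d))
          (-1) ^+ #|D| * f (gcd_set D)
  = \sum_(D : {set 'I_d} | D \subset Pred d)
      \sum_(1 <= e < d.+1 | (e %| d)%N)
         (if D \subset A e then (-1) ^+ #|D| * G e else 0).
  rewrite [RHS](bigD1 set0) ?sub0set //=; congr (_ + _).
    rewrite fE ?d0 //; apply: eq_bigr => e _.
    by rewrite sub0set cards0 expr0 mul1r.
  apply: eq_big => [D|D /andP[D0 DP]]; first by rewrite andbC.
  have gd : (gcd_set D %| d)%N.
    have [i iD] := set0Pn _ D0.
    move/subsetP: DP => /(_ i iD); rewrite inE => /and3P[_ id _].
    apply: dvdn_trans id; move: (dvdnn (gcd_set D)).
    by rewrite {2}/gcd_set gcd_setP => /forall_inP; apply.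
  have g0 : (0 < gcd_set D)%N by rewrite (dvdn_gt0 d0).
  have gle : (gcd_set D <= d)%N by rewrite dvdn_leq.
  rewrite fE ?g0 /=; last by apply: leq_trans dN.
  rewrite (big_cat_nat _ (n := (gcd_set D).+1) (p := d.+1)) ?ltnS //=.
  rewrite [X in _ = _ + X]big_nat_cond [X in _ = _ + X]big1 ?addr0; last first.
    move=> e /andP[/andP[lt _] _]; rewrite subA DP /=.
    by case: ifP => // /(dvdn_leq g0); rewrite leqNgt lt.
  rewrite mulr_sumr [LHS]big_mkcond [RHS]big_mkcond /=.
  apply: eq_bigr => e _; rewrite subA DP /=.
  case: ifP => eg; last by case: ifP.
  by rewrite (dvdn_trans eg gd).
rewrite exchange_big /=.
rewrite big_mkcond big_nat_recr //= dvdnn big_nat_cond big1 ?add0r; last first.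
  move=> e /andP[/andP[e0 ed] _]; case: ifP => // edv.
  rewrite -big_mkcondr /= (eq_bigl (fun D : {set 'I_d} => D \subset A e)); last first.
    by move=> D; rewrite subA; case: (D \subset Pred d).
  rewrite -mulr_suml sum_signed_subsets.
  suff -> : (A e == set0) = false by rewrite mul0r.
  (* Write d = k e with k > 1. For the least prime divisor r of k, the number d / r belongs to
     [Pred d] and is still a multiple of e, so [A e] is not empty. *)
  case/dvdnP: edv => k dE.
  have k1 : (1 < k)%N by nia.
  have rk := pdiv_dvd k; have rp := pdiv_prime k1.
  have jd : (d %/ pdiv k < d)%N by apply: ltn_Pdiv (prime_gt1 rp) d0.
  apply/negbTE/set0Pn; exists (Ordinal jd); rewrite !inE /=.
  have rd : (pdiv k %| d)%N by rewrite dE dvdn_mulr.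
  rewrite divn_gt0 ?pdiv_gt0 // dvdn_leq //= dvdn_div ?divnA ?mulKn //=.
  by rewrite rp /= dE -divn_mulAC // dvdn_mull.
rewrite -big_mkcondr /= (eq_bigl (fun D : {set 'I_d} => D \subset A d)); last first.
  by move=> D; rewrite subA; case: (D \subset Pred d).
rewrite -mulr_suml sum_signed_subsets (_ : A d = set0) ?eqxx ?mul1r //.
apply/setP => i; rewrite !inE; apply/negP => /andP[/and3P[i0 _ _]].
by move=> /(dvdn_leq i0); rewrite leqNgt ltn_ord.
Qed.

(** Expand [f] as a divisor sum of [G]. On the left [G e] occurs once for each of the n / e
    multiples of e up to n, hence with weight 1 / e; on the right the bracket is [G d] by
    inversion. *)
Lemma sum_gcdn_divisors (f : nat -> rat) n : (0 < n)%N ->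
  n%:R^-1 * (\sum_(1 <= i < n.+1) f (gcdn n i)) =
  \sum_(1 <= d < n.+1 | (d %| n)%N) d%:R^-1 *
    (f d + \sum_(D : {set 'I_d} | (D != set0) && (D \subset Pred d))
             (-1) ^+ #|D| * f (gcd_set D)).
Proof.
move=> n0; have [G fE] := divisor_sum_inverse f n.
have n0R : n%:R != 0 :> rat by rewrite pnatr_eq0 -lt0n.
transitivity (\sum_(1 <= d < n.+1 | (d %| n)%N) d%:R^-1 * G d); last first.
  rewrite big_nat_cond [RHS]big_nat_cond.
  apply: eq_bigr => d /andP[hd _]; rewrite (Pred_inversion fE) //.
transitivity (n%:R^-1 * \sum_(1 <= i < n.+1) \sum_(1 <= e < n.+1 | (e %| n)%N)
    ((e %| i)%N%:R * G e)).
  congr (_ * _); apply: eq_big_nat => i /andP[i0 ilt].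
  have g0 : (0 < gcdn n i)%N by rewrite gcdn_gt0 n0.
  have gn : (gcdn n i <= n)%N by rewrite dvdn_leq // dvdn_gcdl.
  rewrite fE ?g0 //.
  rewrite (big_cat_nat _ (n := (gcdn n i).+1) (p := n.+1)) ?ltnS //=.
  rewrite [X in _ = _ + X]big_nat_cond [X in _ = _ + X]big1 ?addr0; last first.
    move=> e /andP[/andP[lt _] en]; case ei: (e %| i)%N; last by rewrite mul0r.
    have : (e %| gcdn n i)%N by rewrite dvdn_gcd en.
    by move/(dvdn_leq g0); rewrite leqNgt lt.
  rewrite [LHS]big_mkcond [RHS]big_mkcond /=; apply: eq_bigr => e _.
  by rewrite dvdn_gcd; case: (e %| n)%N; case: (e %| i)%N; rewrite ?mul1r ?mul0r.
rewrite exchange_big /= mulr_sumr; apply: eq_bigr => e en.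
rewrite -mulr_suml -natr_sum -divn_count_dvd mulrA; congr (_ * _).
have [k nE] := dvdnP en; move: n0 n0R; rewrite nE => n0 n0R.
have e0 : (0 < e)%N by nia.
rewrite mulnK // natrM invfM mulrC mulrA divff ?mul1r //.
by rewrite natrM mulf_eq0 negb_or in n0R; case/andP: n0R.
Qed.

(** * Counting equivalence classes and orbits *)

(** Taking preimages under [h] maps the classes of [R2] onto those of [R1], and injectively because
    every class of [R2] meets the image of [h]. *)
Lemma card_equivalence_partition_transfer (T1 T2 : finType)
    (R1 : rel T1) (R2 : rel T2) (D1 : {set T1}) (D2 : {set T2}) (h : T1 -> T2) :
  {in D2 & &, equivalence_rel R2} ->
  {in D1, forall x, h x \in D2} ->
  {in D1 &, forall x y, R1 x y = R2 (h x) (h y)} ->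
  {in D2, forall y, exists2 x, x \in D1 & R2 y (h x)} ->
  #|equivalence_partition R1 D1| = #|equivalence_partition R2 D2|.
Proof.
move=> eqR hD hR hS.
pose pre (B : {set T2}) := [set x in D1 | h x \in B].
have R2x x y z : x \in D2 -> y \in D2 -> z \in D2 -> R2 x y -> R2 x z = R2 y z.
  by move=> Dx Dy Dz; case: (eqR x y z Dx Dy Dz) => _.
have R2xx x : x \in D2 -> R2 x x by move=> Dx; case: (eqR x x x Dx Dx Dx).
have preE x : x \in D1 -> pre [set y in D2 | R2 (h x) y] = [set y in D1 | R1 x y].
  by move=> Dx; apply/setP => y; rewrite !inE; case Dy: (y \in D1); rewrite //= hD // hR.
suff -> : equivalence_partition R1 D1 = pre @: equivalence_partition R2 D2.
  apply/card_in_imset => _ _ /imsetP[x Dx ->] /imsetP[y Dy ->] E.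
  have [x1 Dx1 rx] := hS x Dx.
  have : x1 \in pre [set z in D2 | R2 x z] by rewrite !inE Dx1 hD.
  rewrite E !inE => /and3P[_ _ ry]; apply/setP => z; rewrite !inE.
  case Dz: (z \in D2) => //=.
  by rewrite (R2x x (h x1)) ?hD // (R2x y (h x1)) ?hD.
apply/setP => B; apply/imsetP/imsetP => [[x Dx ->]|[_ /imsetP[y Dy ->] ->]].
  exists [set y in D2 | R2 (h x) y]; last by rewrite preE.
  by apply/imsetP; exists (h x); rewrite ?hD.
have [x Dx rx] := hS y Dy; exists x => //.
rewrite -preE //; apply/setP => z; rewrite !inE; case Dz: (z \in D1) => //=.
by rewrite hD //= (R2x y (h x)) ?hD.
Qed.

(* Burnside's lemma; cancellation in a finite monoid is as good as inverses. *)
Lemma orbit_counting (T G : finType) (S : {set T}) (R : rel T)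
    (mul : G -> G -> G) (act : G -> T -> T) :
  (forall h, injective (mul^~ h)) ->
  {in S, forall x g, act g x \in S} ->
  {in S, forall x g h, act g (act h x) = act (mul g h) x} ->
  {in S & &, equivalence_rel R} ->
  {in S &, forall x y, R x y = [exists g, act g x == y]} ->
  (#|equivalence_partition R S| * #|G| =
     \sum_g #|[set x in S | act g x == x]|)%N.
Proof.
move=> mulI actS actM eqR RE.
transitivity (\sum_(x in S) #|[set g | act g x == x]|)%N; last first.
  under eq_bigr do rewrite -sum1_card big_mkcond /=.
  rewrite exchange_big /=.
  apply: eq_bigr => g _.
  rewrite -sum1_card big_mkcond [RHS]big_mkcond; apply: eq_bigr => x _.
  by rewrite !inE; case: (x \in S).
have partP := equivalence_partitionP eqR.
have -> : (\sum_(x in S) #|[set g | act g x == x]| =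
    \sum_(x in cover (equivalence_partition R S)) #|[set g | act g x == x]|)%N.
  by rewrite (cover_partition partP).
rewrite big_trivIset /=; last by case/and3P: partP.
rewrite -sum_nat_const; apply: eq_bigr => _ /imsetP[x Sx ->].
rewrite -cardsT -sum1_card (partition_big (fun g => act g x) (mem [set y in S | R x y])) /=.
  apply: eq_bigr => y; rewrite inE => /andP[Sy].
  rewrite RE // => /existsP[h /eqP hx].
  (* Since [h] carries x to y, the map g |-> g h is a bijection from the stabilizer of y onto the
     elements carrying x to y. *)
  rewrite sum1dep_card; have [mulV mulK mulKV] := injF_bij (mulI h).
  rewrite -(card_imset [set g | act g y == y] (mulI h)); apply: eq_card => g; rewrite !inE /=.
    apply/eqP/imsetP => [gx|[g']]; last first.
    by rewrite inE => /eqP g'y ->; rewrite -actM // hx g'y.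
  exists (mulV g); last by rewrite mulKV.
  by rewrite inE -hx actM // mulKV gx hx.
move=> g _; rewrite inE actS //= RE ?actS //.
by apply/existsP; exists g.
Qed.

Lemma porbit_closed (T : finType) (p : {perm T}) (Y : {set T}) :
  {in Y, forall x, p x \in Y} -> {in Y, forall x, porbit p x \subset Y}.
Proof.
move=> pY x Yx; apply/subsetP => _ /porbitP[i ->].
by elim: i => [|i IH]; rewrite ?perm1 // expgSr permM pY.
Qed.

Lemma card_uniform_porbits (T : finType) (p : {perm T}) (Y : {set T}) m :
  {in Y, forall x, p x \in Y} -> {in Y, forall x, #|porbit p x| = m} ->
  #|Y| = (#|porbit p @: Y| * m)%N.
Proof.
move=> pY om; have pYs := porbit_closed pY.
have E : preim_partition (porbit p) Y = porbit p @: Y.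
  apply: eq_in_imset => x Yx; apply/setP => y; rewrite !inE eq_sym eq_porbit_mem.
  case yx: (y \in porbit p x); rewrite ?andbF // andbT.
  by rewrite (subsetP (pYs x Yx)).
rewrite -E; apply: card_uniform_partition (preim_partitionP (porbit p) Y) => B.
by rewrite E => /imsetP[x Yx ->]; apply: om.
Qed.

(** An invariant predicate supported on [Y] is constant on orbits, so it amounts to the set of
    orbits on which it holds; [F] recovers the predicate from that set. *)
Lemma card_invariant_predicates (T : finType) (p : {perm T}) (Y : {set T}) :
  {in Y, forall x, p x \in Y} ->
  #|[set f : {ffun T -> bool} | [forall x, f x ==> (x \in Y)] &&
     [forall x, f (p x) == f x]]| = (2 ^ #|porbit p @: Y|)%N.
Proof.
move=> pY; have pYs := porbit_closed pY.
pose F (Q : {set {set T}}) : {ffun T -> bool} := [ffun x => porbit p x \in Q].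
rewrite -card_powerset -(@card_in_imset _ _ F); last first.
  move=> Q Q'; rewrite !inE => /subsetP QP /subsetP QP' /ffunP E.
  apply/setP => B; case BP: (B \in porbit p @: Y); last first.
    by rewrite (contraFF (QP B) BP) (contraFF (QP' B) BP).
  by case/imsetP: BP => x _ ->; have := E x; rewrite !ffunE.
apply: eq_card => f; rewrite !inE; apply/andP/imsetP.
  move=> [/forallP fY /forallP fp].
  have fP x y : y \in porbit p x -> f y = f x.
    move=> /porbitP[i ->]; elim: i => [|i IH]; first by rewrite perm1.
    by rewrite expgSr permM (eqP (fp _)).
  exists [set B in porbit p @: Y | [exists x in B, f x]].
    by rewrite inE; apply/subsetP => B; rewrite inE => /andP[].
  apply/ffunP => x; rewrite ffunE inE; apply/idP/andP => [fx|].
    rewrite imset_f ?(implyP (fY x)) //; split => //.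
    by apply/existsP; exists x; rewrite porbit_id.
  by case=> _ /existsP[y /andP[yx fy]]; rewrite -(fP x y).
move=> [Q]; rewrite inE => /subsetP QP ->; split.
  apply/forallP => x; rewrite ffunE; apply/implyP => /QP /imsetP[y Yy E].
  by rewrite (subsetP (pYs y Yy)) // -E porbit_id.
apply/forallP => x; rewrite !ffunE; apply/eqP; congr (_ \in Q).
by apply/eqP; rewrite eq_porbit_mem; have := mem_porbit p 1 x; rewrite expg1.
Qed.

(** * Upper central series *)

Section LoopSeries.

Variables (T : Type) (op : T -> T -> T).
Hypothesis L : is_loop op.

Lemma loop_proj_eqP (N : classical_sets.set T) : normal_subloop op N ->
  forall x y, loop_proj op N x = loop_proj op N y <-> exists2 n, N n & y = op x n.
Proof.
move=> [T' [op' [f [L' fM NE]]]] x y.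
rewrite loop_projP (normal_coset_eq L L' fM NE); split=> [fxy|[n]].
  have [n nE] := loop_divl L x y; exists n => //; rewrite NE /=.
  by apply: (neutral_unitl (a := f x) L'); rewrite -fM nE fxy.
by rewrite NE /= => fn ->; rewrite fM (fn _).2.
Qed.

Definition congruent (N : classical_sets.set T) (x y : T) : Prop :=
  exists2 n, N n & y = op x n.

(** Evaluating the center equations of the quotient on coset representatives turns them into
    congruences in the loop itself, so that later arguments avoid the quotient type. *)
Lemma upper_centralSP i x : upper_central op i.+1 x <->
  forall y z, let N := upper_central op i in
    [/\ congruent N (op x y) (op y x),
        congruent N (op (op x y) z) (op x (op y z)),
        congruent N (op (op y x) z) (op y (op x z))
      & congruent N (op (op y z) x) (op y (op z x))].
Proof.
have nN := upper_central_normal i L.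
have mE := loop_quo_mulE L nN; have pE := loop_proj_eqP nN.
split=> /= [cx y z|cx A B].
  have := cx (loop_proj op _ y) (loop_proj op _ z).
  by rewrite !mE; case=> /pE ? /pE ? /pE ? /pE ?.
rewrite -[A]loop_reprK -[B]loop_reprK !mE.
by have [? ? ? ?] := cx (loop_repr A) (loop_repr B); split; apply/pE.
Qed.

Lemma upper_central1P x : upper_central op 1 x <-> loop_center op x.
Proof.
have c0 a b : congruent (upper_central op 0) a b <-> a = b.
  split=> [[n nn ->]|->]; first by rewrite (nn a).2.
  by have [[e en] _ _] := L; exists e => //; rewrite (en b).2.
rewrite upper_centralSP /=; split=> cx y z; have := cx y z.
  by case=> /c0 ? /c0 ? /c0 ? /c0 ?.
by case=> ? ? ? ?; split; apply/c0.
Qed.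

Lemma upper_centralS i x : upper_central op i x -> upper_central op i.+1 x.
Proof.
have nN := upper_central_normal i L.
have [[e en] _ _] := L.
move=> Nx.
have pE : loop_proj op (upper_central op i) x = loop_proj op _ e.
  by apply/esym/(loop_proj_eqP nN); exists x => //; rewrite (en x).1.
have ne A : loop_quo_mul (loop_proj op (upper_central op i) e) A = A /\
    loop_quo_mul A (loop_proj op (upper_central op i) e) = A.
  by rewrite -[A]loop_reprK !(loop_quo_mulE L nN) (en _).1 (en _).2.
by rewrite /= pE => A B; split; rewrite ?(ne _).1 ?(ne _).2.
Qed.

(** Each term determines the next, so a series that stalls once is constant from there on;
    nilpotency then makes that term the whole loop. *)
Lemma upper_central_strict i : loop_nilpotent op ->
  (forall x, upper_central op i.+1 x -> upper_central op i x) ->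
  forall x, upper_central op i x.
Proof.
move=> [n nE] st.
have E : upper_central op i.+1 = upper_central op i.
  by apply/classical_sets.seteqP; split=> // x; apply: upper_centralS.
have Ek k : upper_central op (k + i) = upper_central op i.
  elim: k => // k IH; rewrite addSn -[RHS]E.
  by rewrite /= IH.
have mono k j x : upper_central op j x -> upper_central op (k + j) x.
  by elim: k => // k IH /IH; apply: upper_centralS.
move=> x; rewrite -(Ek n) addnC; apply: mono.
by rewrite nE.
Qed.

End LoopSeries.

Lemma nilpotent_isomorphic (T1 T2 : Type) (op1 : T1 -> T1 -> T1)
    (op2 : T2 -> T2 -> T2) :
  loop_isomorphic op1 op2 -> is_loop op1 -> loop_nilpotent op1 ->
  is_loop op2 /\ loop_nilpotent op2.
Proof.
move=> [f [g fK gK] fM] L1.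
have gM x y : g (op2 x y) = op1 (g x) (g y).
  by apply: (can_inj fK); rewrite fM !gK.
have fE x : exists y, x = f y by exists (g x).
have [[e en] _ _] := L1.
have L2 : is_loop op2.
  split.
  - by exists (f e) => x; rewrite -[x]gK -!fM (en _).1 (en _).2.
  - move=> a b; have [x xE] := loop_divl L1 (g a) (g b); exists (f x); split.
      by rewrite -[a]gK -fM xE gK.
    by move=> y yE; apply: (can_inj gK); apply: (loop_cancell L1 (a := g a)); rewrite fK xE -gM yE.
  - move=> a b; have [x xE] := loop_divr L1 (g a) (g b); exists (f x); split.
      by rewrite -[a]gK -fM xE gK.
    by move=> y yE; apply: (can_inj gK); apply: (loop_cancelr L1 (a := g a)); rewrite fK xE -gM yE.
move=> [n nE]; split=> //; exists n.
have ucE i x : upper_central op1 i x -> upper_central op2 i (f x).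
  elim: i x => [|i IH] x; first by move=> nx y; rewrite -[y]gK -!fM (nx _).1 (nx _).2.
  move=> /(upper_centralSP L1) cx; apply/(upper_centralSP L2) => y z N2.
  have c a b : congruent op1 (upper_central op1 i) a b -> congruent op2 N2 (f a) (f b).
    by case=> m Nm ->; exists (f m); [apply: IH | rewrite fM].
  have [/c h1 /c h2 /c h3 /c h4] := cx (g y) (g z).
  by move: h1 h2 h3 h4; rewrite !fM !gK.
apply/classical_sets.seteqP; split=> // x _.
by rewrite -[x]gK; apply: ucE; rewrite nE.
Qed.

(** Lagrange's argument: [M] is partitioned into cosets of [N], each the image of [N] under an
    injective left multiplication. *)
Lemma card_normal_dvd (T : finType) (op : T -> T -> T) (N M : classical_sets.set T) :
  is_loop op -> normal_subloop op N -> normal_subloop op M ->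
  (forall x, N x -> M x) ->
  (#|[set x | `[< N x >]]| %| #|[set x | `[< M x >]]|)%N.
Proof.
move=> L nN nM NM; have pE := loop_proj_eqP L nN.
have MM x n : M x -> N n -> M (op x n).
  case: nM NM => [T' [op' [f [L' fM ->]]]] /= NM nx /NM nn y.
  by rewrite fM (nx _).1.
pose R x y := `[< loop_proj op N x = loop_proj op N y >].
have eqR : {in [set x | `[< M x >]] & &, equivalence_rel R}.
  by move=> x y z _ _ _; split; rewrite /R; [apply/asboolP | move=> /asboolP ->].
apply/dvdnP; exists #|equivalence_partition R [set x | `[< M x >]]|.
apply: card_uniform_partition (equivalence_partitionP eqR) => _ /imsetP[x Mx ->].
have opI : injective (op x) by move=> y z; apply: loop_cancell.
rewrite -(card_imset [set x | `[< N x >]] opI); apply: eq_card => y.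
rewrite !inE in Mx *; apply/andP/imsetP => [[_ /asboolP/pE[n Nn ->]]|[n]].
  by exists n => //; rewrite inE; apply/asboolP.
rewrite inE => /asboolP Nn ->; split; apply/asboolP; last by apply/pE; exists n.
by apply: MM => //; apply/asboolP.
Qed.

(** * Finite groups from bare operations *)

Section GroupOfOp.

Variables (T : finType) (op : T -> T -> T) (e : T) (inv : T -> T).
Hypotheses (opA : associative op) (ope : left_id e op) (opV : left_inverse e inv op).

(** An alias of [T] whose parameters are the group axioms, so that a group structure can be declared
    on it and finite group theory applies to [op]. *)
Definition op_group of associative op & left_id e op & left_inverse e inv op :
  Type := T.
Local Notation gT := (op_group opA ope opV).

HB.instance Definition _ := Finite.on gT.
HB.instance Definition _ := Finite_isGroup.Build gT opA ope opV.

Lemma card_op_group : #|[set: gT]| = #|T|.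
Proof.
by rewrite cardsT; apply: (bij_eq_card (f := (fun x : gT => x : T))); exists id.
Qed.

Lemma op_involution : ~~ odd #|T| -> exists2 k, k <> e & op k k = e.
Proof.
move=> To; have To2 : (2 %| #|[set: gT]|)%N by rewrite card_op_group dvdn2.
have [k _ ok] := Cauchy (isT : prime 2) To2.
exists k; last by have := expg_order k; rewrite ok.
by move=> ke; move: ok; rewrite (_ : k = 1%g) ?order1.
Qed.

(** A group of prime order is cyclic, and [psi] sends a to the a-th power of a generator. *)
Lemma op_Fp_isomorphic q : prime q -> #|T| = q ->
  exists2 psi : 'F_q -> T, bijective psi & forall a b, psi (a + b) = op (psi a) (psi b).
Proof.
move=> qp Tq.
have gq : #|[set: gT]| = q by rewrite card_op_group.
have /cyclicP[g gE] : cyclic [set: gT] by apply: prime_cyclic; rewrite gq.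
have og : #[g]%g = q by rewrite /order -gE.
pose psi (a : 'F_q) : gT := (g ^+ (a : nat))%g.
have psiI : injective psi.
  move=> a b /eqP; rewrite /psi eq_expg_mod_order og => /eqP.
  have lt (c : 'F_q) : (c < q)%N by have := ltn_ord c; rewrite [X in (_ < X)%N -> _]Fp_cast.
  by rewrite !modn_small // => /val_inj.
exists psi; first by apply: inj_card_bij; rewrite // Tq card_Fp.
move=> a b; rewrite /psi /=.
have -> : op (g ^+ a)%g (g ^+ b)%g = (g ^+ (a + b))%g by rewrite expgD.
(* The modulus built into the type ['F_q] equals q only through [Fp_cast]. *)
by rewrite -[RHS]expg_mod_order og /=; congr (g ^+ (_ %% _))%g; apply: Fp_cast.
Qed.

End GroupOfOp.

(** * The center of a nilpotent loop of order 2q *)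

Section IndexTwo.

Variables (T : finType) (op : T -> T -> T).
Hypothesis L : is_loop op.
Let Z := [set x | `[< loop_center op x >]].

(** Otherwise the loop is the union of [Z] and a coset x [Z]. Pulling out central factors reduces
    all commutativity and associativity questions to products of x with itself, which makes x
    central. *)
Lemma center_index2 : #|T| = (2 * #|Z|)%N -> False.
Proof.
move=> Tq.
have ZP z : z \in Z -> loop_center op z by rewrite inE => /asboolP.
have zC z y : z \in Z -> op z y = op y z by move=> /ZP/(_ y y)[].
have z1 z y w : z \in Z -> op (op z y) w = op z (op y w) by move=> /ZP/(_ y w)[].
have z2 z y w : z \in Z -> op (op y z) w = op y (op z w) by move=> /ZP/(_ y w)[].
have z3 z y w : z \in Z -> op (op y w) z = op y (op w z) by move=> /ZP/(_ y w)[].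
have [[e en] _ _] := L.
have Ze : e \in Z by rewrite inE; apply/asboolP => y w; rewrite !(en _).1 !(en _).2.
have [x xZ] : exists x, x \notin Z.
  apply/existsP; rewrite -negb_forall; apply/negP => /forallP ZT.
  have : Z = [set: T] by apply/setP => y; rewrite ZT inE.
  move=> E; move: Tq; rewrite {1}E cardsT.
  have : (0 < #|T|)%N by apply/card_gt0P; exists e.
  lia.
have opI a : injective (op a) by move=> y w; apply: loop_cancell.
have cov y : y \in Z \/ exists2 c, c \in Z & y = op x c.
  suff : y \in Z :|: op x @: Z.
    by rewrite inE => /orP[|/imsetP]; [left | right].
  suff -> : Z :|: op x @: Z = [set: T] by rewrite inE.
  apply/eqP; rewrite eqEcard subsetT cardsT Tq /=.
  rewrite cardsU card_imset // (_ : Z :&: _ = set0) ?cards0 ?subn0 ?mul2n -?addnn //.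
  apply/setP => w; rewrite [RHS]inE in_setI; apply/negP => /andP[Zw /imsetP[c Zc wE]].
  move/negP: xZ; apply; rewrite wE in Zw.
  have [T' [op' [f [L' fM NE]]]] := loop_center_normal L.
  move/ZP: Zw; move/ZP: Zc; rewrite inE; move=> Zc Zw; apply/asboolP; move: Zc Zw.
  by rewrite NE /= => nc; rewrite fM (nc _).2.
have xC y : op x y = op y x.
  by case: (cov y) => [Zy|[c Zc ->]]; rewrite ?(zC y) // z2 // (zC c).
have opC y w : op y w = op w y.
  case: (cov y) => [Zy|[c Zc ->]]; first by rewrite zC.
  by rewrite z2 // (zC c) // -(z3 c) // -(z3 c) // (xC w).
(* For w = x c with c central the claim is (x x) x = x (x x), an instance of [xC]. *)
have xxA w : op (op x x) w = op x (op x w).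
  case: (cov w) => [Zw|[c Zc ->]]; first by rewrite z3.
  by rewrite -(z3 c) // -xC -(z3 c x x) // -(z3 c).
have xA y w : op (op x y) w = op x (op y w).
  case: (cov y) => [Zy|[c Zc ->]]; first by rewrite z2.
  by rewrite -(z3 c) // (z2 c) // (z2 c x w) // xxA.
move/negP: xZ; apply; rewrite inE; apply/asboolP => y w; split=> //.
- by rewrite -(xC y) xA (opC y w) (opC y (op x w)) xA.
- by rewrite -xC -(xC w) (opC y (op x w)) xA (opC w).
Qed.

End IndexTwo.

(* If the center had order q it would have index 2, which is impossible; so it
   has order 2, and then the second center is everything, or the loop is an
   abelian group. *)
Lemma nilpotent_loop_2q (T : finType) (op : T -> T -> T) q :
  prime q -> is_loop op -> loop_nilpotent op -> #|T| = (2 * q)%N ->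
  exists e k, [/\ neutral op e, loop_center op k, k <> e, op k k = e &
    forall x y z, op x (op y z) = op (op x y) z \/
                  op x (op y z) = op (op (op x y) z) k].
Proof.
move=> qp L nil Tq.
have [[e en] _ _] := L.
pose Z i := [set x | `[< upper_central op i x >]].
have ZP i x : x \in Z i <-> upper_central op i x by rewrite inE; split=> /asboolP.
have Zdvd i j : (forall x, upper_central op i x -> upper_central op j x) ->
    (#|Z i| %| #|Z j|)%N.
  exact: (card_normal_dvd L (upper_central_normal i L) (upper_central_normal j L)).
have ZT i : Z i = [set: T] -> forall x, upper_central op i x.
  by move=> E x; apply/ZP; rewrite E inE.
have Zup i : (#|Z i| <= #|Z i.+1| ?= iff (Z i == Z i.+1))%N.
  by apply: subset_leqif_cards; apply/subsetP => x /ZP/(upper_centralS L)/ZP.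
have Zst i : Z i != [set: T] -> (#|Z i| < #|Z i.+1|)%N.
  move=> ZiT; rewrite (ltn_leqif (Zup i)); apply: contra ZiT => /eqP E.
  apply/eqP/setP => x; rewrite [RHS]inE; apply/ZP.
  apply: (upper_central_strict L nil) => y /ZP; rewrite -E.
  by move/ZP.
have Z2q i : (#|Z i| %| 2 * q)%N.
  have [n nE] := nil; have -> : (2 * q = #|Z n|)%N.
    by rewrite -Tq -cardsT; apply: eq_card => x; rewrite inE; apply/esym/ZP; rewrite nE.
  by apply: Zdvd => x _; rewrite nE.
have Z0 : Z 0%N = [set e].
  apply/setP => x; rewrite in_set1; apply/idP/eqP => [/ZP nx|->]; last exact/ZP.
  by rewrite -(nx e).2 (en _).1.
have q1 := prime_gt1 qp.
have Z1gt : (1 < #|Z 1%N|)%N.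
  have := Zst 0%N; rewrite Z0 cards1; apply; apply/eqP => E.
  by have := Tq; rewrite -cardsT -E cards1; lia.
have Z1c x : x \in Z 1%N <-> loop_center op x.
  by rewrite -(upper_central1P L).
have Z1E : Z 1%N = [set x | `[< loop_center op x >]].
  by apply/setP => x; rewrite [RHS]inE; apply/idP/asboolP => /Z1c.
(* If the center is everything, the loop is an abelian group of even order and Cauchy's theorem
   supplies the involution. *)
have [Z1T|Z1T] := eqVneq (Z 1%N) [set: T].
  have zA x y z : op x (op y z) = op (op x y) z.
    have : x \in Z 1%N by rewrite Z1T inE.
    by move=> /Z1c/(_ y z)[].
  have [inv invP] := choice (fun x => loop_divr L x e).
  have [|k ke kk] := op_involution zA (fun x => (en x).1) invP;
    first by rewrite Tq mul2n odd_double.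
  exists e, k; split=> //; last by left.
  by apply/Z1c; rewrite Z1T inE.
have full i : #|Z i| = (2 * q)%N -> Z i = [set: T].
  by move=> E; apply/eqP; rewrite eqEcard subsetT cardsT Tq E /=.
have Z12 : #|Z 1%N| = 2.
  have := Z2q 1%N; case cq: (coprime q #|Z 1%N|).
    by rewrite Gauss_dvdl 1?coprime_sym // => /dvdn_leq; lia.
  move: cq; rewrite prime_coprime // => /negbFE/dvdnP[m mE].
  rewrite mE dvdn_pmul2r ?prime_gt0 // => /dvdn_leq m2; have {}m2 := m2 isT.
  have [m2E|m1] : m = 2 \/ m = 1%N by nia.
    by case/eqP: Z1T; apply: full; rewrite mE m2E.
  by case: (center_index2 L); rewrite -Z1E mE m1 mul1n.
have /cards2P[a [b [ab Zab]]] : #|Z 1%N| == 2%N by rewrite Z12.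
have [k ke Zk] : exists2 k, k <> e & Z 1%N = [set e; k].
  have : e \in Z 1%N by apply/ZP/(upper_centralS L)/ZP; rewrite Z0 inE.
  rewrite Zab !inE => /orP[] /eqP eE.
    by exists b; rewrite eE //; apply/eqP; rewrite eq_sym.
  by exists a; [rewrite eE; apply/eqP | rewrite eE setUC].
have kc : loop_center op k by apply/Z1c; rewrite Zk !inE eqxx orbT.
have [T' [op' [f [L' fM NE]]]] := upper_central_normal 1 L.
have kk : op k k = e.
  have k1 : upper_central op 1 k by apply/upper_central1P.
  have : upper_central op 1 (op k k).
    by move: k1; rewrite NE /= => nk; rewrite fM (nk _).1.
  move/ZP; rewrite Zk !inE => /orP[/eqP //|/eqP kkk]; case: ke.
  by apply: (loop_cancell L (a := k)); rewrite kkk (en k).2.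
(* The order of the second center is a multiple of 2, exceeds 2 and divides 2q; since q is prime, it
   is 2q. *)
have Z2T : Z 2%N = [set: T].
  apply: full; have /dvdnP[m mE] := Zdvd 1%N 2%N (@upper_centralS _ _ L 1).
  have := Zst 1%N Z1T; have := Z2q 2%N; rewrite mE Z12 mulnC.
  by rewrite dvdn_pmul2l // => /((primeP qp).2 _)/orP[/eqP->|/eqP->].
exists e, k; split=> // x y z.
have /(upper_centralSP L)/(_ y z)[_ [n nZ nE] _ _] := ZT _ Z2T x.
have : n \in Z 1%N by apply/ZP.
by rewrite nE Zk !inE => /orP[] /eqP ->; [left; rewrite (en _).2 | right].
Qed.

(** * Loops given by cocycles *)

(** An arbitrary function, since a loop extension imposes no associativity on its factor set; Z/2 is
    [bool] with [addb] as addition. *)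
Definition cocycle (q : nat) := {ffun 'F_q * 'F_q -> bool}.

Definition cocycle_mul (q : nat) (f : cocycle q) (a b : bool * 'F_q) :
  bool * 'F_q := (a.1 (+) b.1 (+) f (a.2, b.2), a.2 + b.2).

Definition free_pairs (q : nat) : {set 'F_q * 'F_q} :=
  [set z | [&& z.1 != 0, z.2 != 0 & z.1 != z.2]].

(* Normal forms of cocycles modulo the functions a(x) + b(y) + c(x + y). *)
Definition normal_cocycles (q : nat) : {set cocycle q} :=
  [set f : cocycle q | [forall z, f z ==> (z \in free_pairs q)]].

Lemma normal_cocycleP q (f : cocycle q) : f \in normal_cocycles q <->
  [/\ forall x, f (x, 0) = false, forall y, f (0, y) = false
    & forall x, f (x, x) = false].
Proof.
rewrite inE; split=> [/forallP h|[h1 h2 h3]].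
  by split=> x; apply/negP => /(implyP (h _)); rewrite inE /= ?eqxx ?andbF.
apply/forallP => -[x y]; apply/implyP; rewrite inE /=; apply: contraTT.
by rewrite !negb_and !negbK => /or3P[] /eqP ->; rewrite ?h1 ?h2 ?h3.
Qed.

Section CocycleLoop.

Variables (q : nat) (f : cocycle q).
Hypothesis fN : f \in normal_cocycles q.

Lemma cocycle_mul_loop : is_loop (cocycle_mul f).
Proof.
have [f1 f2 _] := (normal_cocycleP f).1 fN; split.
- by exists (false, 0) => -[a x]; rewrite /cocycle_mul /= f1 f2 add0r addr0 !addbF.
- move=> [a x] [b y]; exists (a (+) b (+) f (x, y - x), y - x); split.
    by rewrite /cocycle_mul /= (addrC x) subrK; congr (_, _); case: a; case: b; case: (f _).
  by case=> c z [<- <-]; rewrite /= (addrC x z) addrK; congr (_, _); case: a; case: c; case: (f _).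
- move=> [a x] [b y]; exists (a (+) b (+) f (y - x, x), y - x); split.
    by rewrite /cocycle_mul /= subrK; congr (_, _); case: a; case: b; case: (f _).
  by case=> c z [<- <-]; rewrite /= addrK; congr (_, _); case: a; case: c; case: (f _).
Qed.

(** The pairs (a, 0) are central because [f] vanishes on the axes, and modulo them only the
    commutative and associative addition of F_q remains. *)
Lemma cocycle_mul_nilpotent : loop_nilpotent (cocycle_mul f).
Proof.
have [f1 f2 _] := (normal_cocycleP f).1 fN.
have L := cocycle_mul_loop.
have Z1 a : upper_central (cocycle_mul f) 1 (a, 0).
  apply/(upper_central1P L) => -[b y] [c z].
  rewrite /cocycle_mul /= !f1 !f2 !add0r !addr0; split; congr (_, _);
    by case: a; case: b; case: c; case: (f _).
have cg u v : u.2 = v.2 -> congruent (cocycle_mul f) (upper_central (cocycle_mul f) 1) u v.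
  case: u v => [a x] [b y] /= ->; exists (a (+) b, 0); first exact: Z1.
  by rewrite /cocycle_mul /= f1 addr0; congr (_, _); case: a; case: b.
exists 2%N; apply/classical_sets.seteqP; split=> // x _.
apply/(upper_centralSP L) => y z N.
by split; apply: cg => /=; rewrite ?addrA // addrC.
Qed.

End CocycleLoop.

(** * Halving and additive maps in F_q *)

Lemma Fp_two_neq0 q : prime q -> odd q -> (2%:R : 'F_q) != 0.
Proof.
move=> qp qo; rewrite -(dvdn_pcharf (pchar_Fp qp)).
by rewrite dvdn_prime2 //; apply: contraTneq qo => ->.
Qed.

Lemma Fp_double_eq0 q (x : 'F_q) : prime q -> odd q -> x + x = 0 -> x = 0.
Proof.
move=> qp qo /eqP; rewrite -mulr2n -mulr_natl mulf_eq0 (negbTE (Fp_two_neq0 qp qo)).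
by move/eqP.
Qed.

Lemma Fp_halfD q (x : 'F_q) : prime q -> odd q -> x / 2%:R + x / 2%:R = x.
Proof. by move=> qp qo; rewrite -mulrDl -mulr2n -[x *+ 2]mulr_natr mulfK ?Fp_two_neq0. Qed.

Lemma Fp_additive q (h : 'F_q -> 'F_q) : {morph h : x y / x + y} ->
  forall x, h x = h 1 * x.
Proof.
move=> hD x.
have h0 : h 0 = 0 by apply: (addrI (h 0)); rewrite -hD !addr0.
rewrite -[x]natr_Zp mulr_natr; elim: (nat_of_ord x) => [|n IH]; first by rewrite !mulr0n.
by rewrite !mulrS hD IH.
Qed.

(** * Nilpotent loops of order 2q as cocycle loops *)

Section NilpotentIsCocycle.

Variables (q : nat) (T : finType) (op : T -> T -> T).
Hypotheses (qp : prime q) (qo : odd q) (L : is_loop op) (Tq : #|T| = (2 * q)%N).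
Variables e k : T.
Hypotheses (en : neutral op e) (kc : loop_center op k) (ke : k <> e) (kk : op k k = e).
Hypothesis opA : forall x y z, op x (op y z) = op (op x y) z \/
                               op x (op y z) = op (op (op x y) z) k.

(** A fixed-point-free involution whose orbits are the cosets of the central subloop {e, k}. *)
Let sh x := op x k.

Let shK : involutive sh.
Proof. by move=> x; rewrite /sh; have [_ _ -> _] := kc x k; rewrite kk (en x).2. Qed.

Let shN x : sh x <> x.
Proof. by move=> E; apply: ke; apply: (loop_cancell L (a := x)); rewrite [LHS]E (en x).2. Qed.

Let shr x y : op x (sh y) = sh (op x y).
Proof. by rewrite /sh; have [_ _ _ ->] := kc x y. Qed.

Let shl x y : op (sh x) y = sh (op x y).
Proof. by rewrite {1}/sh; have [_ _ -> _] := kc x y; have [-> _ _ _] := kc y y; rewrite shr. Qed.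

(** The element of smaller enumeration rank represents its pair {x, [sh x]}; the type [Q] of
    representatives below models the quotient by {e, k}. *)
Let rp x := if (enum_rank x < enum_rank (sh x))%N then x else sh x.

Let rpsh x : rp (sh x) = rp x.
Proof.
rewrite /rp shK; case: ltngtP => // E.
by case: (@shN x); apply/enum_rank_inj/val_inj.
Qed.

Let rpP x : rp x = x \/ rp x = sh x.
Proof. by rewrite /rp; case: ifP; [left | right]. Qed.

Let rpK x : rp (rp x) = rp x.
Proof. by case: (rpP x) => E; rewrite {1}E ?rpsh. Qed.

Let rp_eq x y : rp x = rp y -> x = y \/ x = sh y.
Proof.
case: (rpP x) => ->; case: (rpP y) => -> E; [by left | by right | |].
  by right; rewrite -E shK.
by left; rewrite -[x]shK E shK.
Qed.

Let rpM x y : rp (op (rp x) (rp y)) = rp (op x y).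
Proof. by case: (rpP x) => ->; case: (rpP y) => ->; rewrite ?shl ?shr ?rpsh. Qed.

Let Q := {x : T | rp x == x}.
Let qpi x : Q := exist _ (rp x) (introT eqP (rpK x)).
Let qop (a b : Q) : Q := qpi (op (val a) (val b)).

Let qpi_val (a : Q) : qpi (val a) = a.
Proof. by apply/val_inj/eqP; case: a. Qed.

Let qpiM x y : qpi (op x y) = qop (qpi x) (qpi y).
Proof. by apply: val_inj; rewrite /= rpM. Qed.

Let card_quotient : #|{: Q}| = q.
Proof.
have : #|{: bool * Q}| = #|T|.
  apply: (bij_eq_card (f := fun c : bool * Q => if c.1 then sh (val c.2) else val c.2)).
  exists (fun x => (rp x != x, qpi x)).
    case=> b a /=; have /eqP ra := valP a; case: b; rewrite ?rpsh ra; congr (_, _).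
    - by apply/eqP => E; apply: (@shN (val a)).
    - by rewrite -[RHS]qpi_val; apply: val_inj; rewrite /= rpsh.
    - by rewrite eqxx.
    - by rewrite qpi_val.
  move=> x /=; case: eqP => //=.
  by case: (rpP x) => // -> _; rewrite shK.
by rewrite card_prod card_bool Tq => /eqP; rewrite eqn_mul2l /= => /eqP.
Qed.

(** Associativity holds up to a factor k, which the quotient does not see; so the quotient is a
    group of prime order q, hence a copy of F_q. *)
Lemma projection_to_Fp : exists2 p : T -> 'F_q,
  (forall x y, p (op x y) = p x + p y) /\ (forall i, exists x, p x = i)
  & forall x y, p x = p y <-> x = y \/ x = op y k.
Proof.
have qA : associative qop.
  move=> a b c; rewrite -(qpi_val a) -(qpi_val b) -(qpi_val c) -!qpiM.
  apply: val_inj => /=.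
  by case: (opA (val a) (val b) (val c)) => ->; rewrite ?[rp (op _ k)]rpsh.
have qe : left_id (qpi e) qop.
  by move=> a; rewrite -(qpi_val a) -qpiM (en _).1.
have [inv invP] := choice (fun x => loop_divr L x e).
have qV : left_inverse (qpi e) (fun a => qpi (inv (val a))) qop.
  by move=> a; rewrite -{2}(qpi_val a) -qpiM invP.
have [psi [psi' psiK psiK'] psiM] := op_Fp_isomorphic qA qe qV qp card_quotient.
exists (fun x => psi' (qpi x)); first split=> [x y|i].
- by apply: (can_inj psiK); rewrite psiM !psiK' qpiM.
- by exists (val (psi i)); rewrite qpi_val psiK.
move=> x y; split=> [/(can_inj psiK')/(congr1 val)/rp_eq //|[->//|->]].
by congr psi'; apply: val_inj; rewrite /= -[op y k]/(sh y) rpsh.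
Qed.

(* The section choosing the unique square in each fibre is normalized on the
   diagonal. *)
Lemma extension_is_cocycle :
  exists2 f : cocycle q, f \in normal_cocycles q & loop_isomorphic (cocycle_mul f) op.
Proof.
have [p [pM /choice[s sP]] pE] := projection_to_Fp.
pose shb (b : bool) x := if b then sh x else x.
pose sg (i : 'F_q) := op (s (i / 2%:R)) (s (i / 2%:R)).
have sq x y : p x = p y -> op x x = op y y.
  by move=> /pE[->//|->]; rewrite -[op y k]/(sh y) shl shr shK.
have psg i : p (sg i) = i by rewrite pM !sP Fp_halfD.
have pe : p e = 0 by apply: (addrI (p e)); rewrite -pM (en e).1 addr0.
have sg0 : sg 0 = e by rewrite /sg mul0r (sq _ e) ?(en e).1 // sP pe.
(* [sg i] lies over i, which is half of i + i, so its square is the chosen element over i + i. This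
   makes the cocycle vanish on the diagonal. *)
have sgD i : op (sg i) (sg i) = sg (i + i).
  by rewrite [RHS]/sg; apply: sq; rewrite psg sP mulrDl Fp_halfD.
pose f : cocycle q := [ffun z => op (sg z.1) (sg z.2) != sg (z.1 + z.2)].
have sgM i j : op (sg i) (sg j) = shb (f (i, j)) (sg (i + j)).
  rewrite ffunE /=; case: eqP => //= ne.
  by case: (pE (op (sg i) (sg j)) (sg (i + j))).1 => //; rewrite pM !psg.
exists f.
  apply/normal_cocycleP; split=> x; rewrite ffunE /= ?sg0 ?addr0 ?add0r;
    by rewrite ?(en _).1 ?(en _).2 ?sgD ?eqxx.
have shbE a b x y : op (shb a x) (shb b y) = shb (a (+) b) (op x y).
  by case: a; case: b => /=; rewrite ?shl ?shr ?shK.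
exists (fun u : bool * 'F_q => shb u.1 (sg u.2)); last first.
  move=> [a x] [b y] /=; rewrite shbE sgM.
  by case: a; case: b; case: (f _) => //=; rewrite [RHS]shK.
apply: inj_card_bij; last by rewrite Tq card_prod card_bool card_Fp.
have pshb a x : p (shb a x) = p x by case: a => //=; apply/pE; right.
move=> [a x] [b y] /= E.
have xy : x = y by rewrite -(psg x) -(psg y) -(pshb a (sg x)) -(pshb b (sg y)) E.
rewrite -{}xy in E *; congr (_, _); case: a b E => [] [] //= E; first by case: (@shN (sg x)).
by case: (@shN (sg x)).
Qed.

End NilpotentIsCocycle.

Lemma nilpotent_loop_cocycle q (T : finType) (op : T -> T -> T) :
  prime q -> odd q -> #|T| = (2 * q)%N -> is_loop op -> loop_nilpotent op ->
  exists2 f : cocycle q, f \in normal_cocycles q & loop_isomorphic (cocycle_mul f) op.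
Proof.
move=> qp qo Tq L nil.
have [e [k [en kc ke kk opA]]] := nilpotent_loop_2q qp L nil Tq.
exact: (extension_is_cocycle qp qo L Tq en kc ke kk opA).
Qed.

(** * Isotopisms and equivalence of cocycles *)

(** Three independent functions appear because an isotopism may change the section separately for
    left factors, right factors and products. *)
Definition cocycle_equiv q (f g : cocycle q) : Prop :=
  exists a b c : 'F_q -> bool,
    forall x y, g (x, y) = f (x, y) (+) a x (+) b y (+) c (x + y).

Lemma cocycle_equiv_refl q (f : cocycle q) : cocycle_equiv f f.
Proof. by exists (fun=> false), (fun=> false), (fun=> false) => x y; rewrite !addbF. Qed.

Lemma cocycle_equiv_sym q (f g : cocycle q) : cocycle_equiv f g -> cocycle_equiv g f.
Proof.
move=> [a [b [c E]]]; exists a, b, c => x y; rewrite E.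
by case: (f _); case: (a _); case: (b _); case: (c _).
Qed.

Lemma cocycle_equiv_trans q (f g h : cocycle q) :
  cocycle_equiv f g -> cocycle_equiv g h -> cocycle_equiv f h.
Proof.
move=> [a [b [c E]]] [a' [b' [c' E']]].
exists (fun x => a x (+) a' x), (fun x => b x (+) b' x), (fun x => c x (+) c' x) => x y.
rewrite E' E; case: (f _); case: (a _); case: (b _); case: (c _);
  by case: (a' _); case: (b' _); case: (c' _).
Qed.

Definition scaled_shift q (u s t : 'F_q) (z : 'F_q * 'F_q) :=
  (u * z.1 + s, u * z.2 + t).

Definition cocycle_pull q (f : cocycle q) (u s t : 'F_q) : cocycle q :=
  [ffun z => f (scaled_shift u s t z)].

Lemma cocycle_equiv_pull q (f g : cocycle q) u s t : cocycle_equiv f g ->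
  cocycle_equiv (cocycle_pull f u s t) (cocycle_pull g u s t).
Proof.
move=> [a [b [c E]]].
exists (fun x => a (u * x + s)), (fun x => b (u * x + t)), (fun x => c (u * x + (s + t))) => x y.
by rewrite !ffunE /scaled_shift /= E; congr (_ (+) c _); ring.
Qed.

Section Isotopisms.

Variables (q : nat) (f g : cocycle q).
Hypotheses (qp : prime q) (qo : odd q).
Hypothesis (gN : g \in normal_cocycles q).
Variables a b c : bool * 'F_q -> bool * 'F_q.
Hypotheses (abij : bijective a) (bbij : bijective b) (cbij : bijective c).
Hypothesis abcM : forall x y, cocycle_mul g (a x) (b y) = c (cocycle_mul f x y).

Let flip (x : bool * 'F_q) := (~~ x.1, x.2).
Let flipK : involutive flip.
Proof. by case=> d x; rewrite /flip /= negbK. Qed.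

Let flipl h x y : cocycle_mul h (flip x) y = flip (cocycle_mul h x y).
Proof. by rewrite /cocycle_mul /flip /= !addNb. Qed.

Let flipr h x y : cocycle_mul h x (flip y) = flip (cocycle_mul h x y).
Proof. by rewrite /cocycle_mul /flip /= addbN addNb. Qed.

(* Translation by the central involution is transported by an isotopism to a
   translation by a central element of order 2, hence to itself. *)
Lemma isotopism_flip :
  [/\ forall x, a (flip x) = flip (a x), forall x, b (flip x) = flip (b x)
    & forall x, c (flip x) = flip (c x)].
Proof.
have [g1 g2 _] := (normal_cocycleP g).1 gN.
have [[a' aK a'K] [b' bK b'K] [c' cK c'K]] := And3 abij bbij cbij.
pose C x := c (flip (c' x)).
pose e : bool * 'F_q := (false, 0).
have xe x : cocycle_mul g x e = x.
  by case: x => d x; rewrite /cocycle_mul /= g1 addr0 !addbF.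
have ex x : cocycle_mul g e x = x.
  by case: x => d x; rewrite /cocycle_mul /= g2 add0r !addbF.
(* [C], the transport of [flip] along [c], can be pulled out of either factor of a product in the
   second loop; hence it is multiplication by [C e]. *)
have CA x y : cocycle_mul g (a (flip (a' x))) y = C (cocycle_mul g x y).
  by rewrite -{1}[y]b'K abcM flipl -[x in RHS]a'K -[y in RHS]b'K abcM /C cK.
have CB x y : cocycle_mul g x (b (flip (b' y))) = C (cocycle_mul g x y).
  by rewrite -{1}[x]a'K abcM flipr -[x in RHS]a'K -[y in RHS]b'K abcM /C cK.
have AC x : a (flip (a' x)) = C x by rewrite -[LHS]xe CA xe.
have BC x : b (flip (b' x)) = C x by rewrite -[LHS]ex CB ex.
have CK : involutive C by move=> x; rewrite /C cK flipK c'K.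
have Cr x y : cocycle_mul g x (C y) = C (cocycle_mul g x y) by rewrite -BC CB.
(* The square of [C e] is e, so its second coordinate doubles to 0 and vanishes, q being odd. Its
   first coordinate is then true, as otherwise [flip] would have a fixed point. *)
have Cn : (C e).2 = 0.
  apply: Fp_double_eq0 => //; have := Cr (C e) e.
  by rewrite xe CK => /(congr1 snd).
have Ce : (C e).1.
  case E: (C e).1 => //; suff : (flip (c' e)).1 = (c' e).1 by case: (c' e) => -[].
  congr fst; rewrite -[LHS]cK -/(C e) [C e]surjective_pairing E Cn //.
have CE x : C x = flip x.
  rewrite -[x in LHS]xe -Cr [C e]surjective_pairing Ce Cn -[(true, 0)]/(flip e).
  by rewrite flipr xe.
by split=> x; [rewrite -[RHS]CE -AC aK | rewrite -[RHS]CE -BC bK | rewrite -[RHS]CE /C cK].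
Qed.

(** Commuting with [flip], the three bijections descend to maps of F_q with a0 x + b0 y = c0 (x +
    y). They therefore differ by constants from one additive map, which is multiplication by u = h
    1; first coordinates yield the equivalence. *)
Lemma isotopism_affine : exists u s t, [/\ u != 0,
  forall x, (a x).2 = u * x.2 + s, forall x, (b x).2 = u * x.2 + t,
  forall x, (c x).2 = u * x.2 + (s + t)
  & cocycle_equiv f (cocycle_pull g u s t)].
Proof.
have [aF bF cF] := isotopism_flip.
have redE h : (forall x, h (flip x) = flip (h x)) -> forall x, (h x).2 = (h (false, x.2)).2.
  move=> hF [[] x] //=; by rewrite -[(true, x)]/(flip (false, x)) hF.
pose a0 x := (a (false, x)).2; pose b0 x := (b (false, x)).2; pose c0 x := (c (false, x)).2.
have abc0 x y : a0 x + b0 y = c0 (x + y).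
  have := congr1 snd (abcM (false, x) (false, y)).
  by rewrite (redE c).
pose h x := c0 x - c0 0.
have c00 : c0 0 = a0 0 + b0 0 by rewrite abc0 addr0.
have aE x : a0 x = h x + a0 0 by rewrite /h -[x in c0 x]addr0 -abc0 c00; ring.
have bE x : b0 x = h x + b0 0 by rewrite /h -[x in c0 x]add0r -abc0 c00; ring.
have cE x : c0 x = h x + (a0 0 + b0 0) by rewrite /h c00; ring.
have hD : {morph h : x y / x + y}.
  by move=> x y; rewrite {1}/h -abc0 aE bE c00; ring.
have hE := Fp_additive hD.
exists (h 1), (a0 0), (b0 0); split.
(* If u were 0, then [c] would send (false, 1) to the image of (false, 0) or to its flip, against
   injectivity. *)
- apply/eqP => h1.
  have : (c (false, 1)).2 = (c (false, 0)).2.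
    by rewrite -/(c0 1) -/(c0 0) [LHS]cE [RHS]cE (hE 0) h1 mul0r.
  have cI := bij_inj cbij => E.
  have [E'|E'] : c (false, 1) = c (false, 0) \/ c (false, 1) = c (flip (false, 0)).
    rewrite cF; move: E; case: (c (false, 1)) (c (false, 0)) => [d x] [d' x'] /= ->.
    by rewrite /flip /=; case: d; case: d'; [left|right|right|left].
    by have [/eqP] := cI _ _ E'; rewrite oner_eq0.
  by have [] := cI _ _ E'.
- by move=> x; rewrite (redE a) // -/(a0 _) aE hE.
- by move=> x; rewrite (redE b) // -/(b0 _) bE hE.
- by move=> x; rewrite (redE c) // -/(c0 _) cE hE.
exists (fun x => (a (false, x)).1), (fun x => (b (false, x)).1), (fun x => (c (false, x)).1).
move=> x y; rewrite ffunE /scaled_shift /= -!hE -aE -bE.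
have := congr1 fst (abcM (false, x) (false, y)); rewrite /cocycle_mul /=.
have -> : (c (f (x, y), x + y)).1 = f (x, y) (+) (c (false, x + y)).1.
  by case: (f _) => //; rewrite -[(true, _)]/(flip (false, x + y)) cF.
rewrite -/(a0 x) -/(b0 y).
case: (g _); case: (a _).1; case: (b _).1; case: (c _).1; by case: (f _).
Qed.

End Isotopisms.

Lemma isotopic_cocycleP q (f g : cocycle q) : prime q -> odd q ->
  g \in normal_cocycles q ->
  isotopic (cocycle_mul f) (cocycle_mul g) <->
  exists u s t, u != 0 /\ cocycle_equiv f (cocycle_pull g u s t).
Proof.
move=> qp qo gN; split=> [[a [b [c [ab bb cb M]]]]|[u [s [t [u0 [a [b [c E]]]]]]]].
  have [u [s [t [u0 _ _ _ E]]]] := isotopism_affine qp qo gN ab bb cb M.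
  by exists u, s, t.
have bij (h : 'F_q -> bool) v : bijective (fun x : bool * 'F_q => (x.1 (+) h x.2, u * x.2 + v)).
  exists (fun x => (x.1 (+) h ((x.2 - v) / u), (x.2 - v) / u)) => -[d x] /=.
    by rewrite addrK mulrC mulKf // addbK.
  by rewrite mulrCA divff // mulr1 subrK addbK.
exists (fun x => (x.1 (+) a x.2, u * x.2 + s)), (fun x => (x.1 (+) b x.2, u * x.2 + t)),
  (fun x => (x.1 (+) c x.2, u * x.2 + (s + t))); split=> // -[d x] [d' y].
rewrite /cocycle_mul /=; congr (_, _); last by ring.
have := E x y; rewrite ffunE /scaled_shift /= => ->.
case: (f _); case: (a _); case: (b _); case: (c _); by case: d; case: d'.
Qed.

(** * Normal forms of cocycles *)

(** Vanishing on the axes expresses [a] and [b] through [c]; vanishing at (x/2, x/2) then forces c x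
    to be the constant a 0 + b 0, and the correction cancels. *)
Lemma cocycle_equiv_normal q (f g : cocycle q) : prime q -> odd q ->
  f \in normal_cocycles q -> g \in normal_cocycles q -> cocycle_equiv f g -> f = g.
Proof.
move=> qp qo /normal_cocycleP[f1 f2 f3] /normal_cocycleP[g1 g2 g3] [a [b [c E]]].
have aE x : a x = b 0 (+) c x.
  by have := E x 0; rewrite f1 g1 addr0; case: (a _); case: (b _); case: (c _).
have bE x : b x = a 0 (+) c x.
  by have := E 0 x; rewrite f2 g2 add0r; case: (a _); case: (b _); case: (c _).
have cE x : c x = a 0 (+) b 0.
  have := E (x / 2%:R) (x / 2%:R); rewrite f3 g3 Fp_halfD // aE (bE (x / _)).
  by case: (a 0); case: (b 0); case: (c (_ / _)); case: (c x).
apply/ffunP => -[x y]; rewrite E aE (bE y) !cE.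
have := E 0 0; rewrite f1 g1 cE.
by case: (f _); case: (a 0); case: (b 0).
Qed.

Lemma cocycle_pull_normal q (f : cocycle q) u :
  f \in normal_cocycles q -> cocycle_pull f u 0 0 \in normal_cocycles q.
Proof.
move=> /normal_cocycleP[f1 f2 f3]; apply/normal_cocycleP.
by split=> x; rewrite ffunE /scaled_shift /= !addr0 ?mulr0.
Qed.

(** For an isomorphism the translation parts s, t and s + t coincide, hence are 0. Scaling preserves
    normal forms, so equivalence becomes equality. *)
Lemma isomorphic_cocycleP q (f g : cocycle q) : prime q -> odd q ->
  f \in normal_cocycles q -> g \in normal_cocycles q ->
  loop_isomorphic (cocycle_mul f) (cocycle_mul g) <->
  exists u, u != 0 /\ cocycle_pull g u 0 0 = f.
Proof.
move=> qp qo fN gN; split=> [[h hb M]|[u [u0 E]]].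
  have [u [s [t [u0 ah bh ch E]]]] := isotopism_affine qp qo gN hb hb hb (fun x y => esym (M x y)).
  have st : s = t by have := ah (false, 0); rewrite bh /= mulr0 !add0r.
  have t0 : t = 0.
    by have := ah (false, 0); rewrite ch /= mulr0 !add0r st => /(canRL (addrK _)); rewrite subrr.
  exists u; split=> //; apply/esym/cocycle_equiv_normal => //.
    exact: cocycle_pull_normal.
  by move: E; rewrite st t0.
exists (fun x => (x.1, u * x.2)).
  by exists (fun x => (x.1, x.2 / u)) => -[d x] /=; rewrite ?(mulrC u) ?mulfK ?divfK.
move=> [d x] [d' y]; rewrite /cocycle_mul /= -E ffunE /scaled_shift /= !addr0.
by rewrite mulrDr.
Qed.

(* The coboundary of x |-> h(x/2, x/2) takes the value h(x, x) at (x, x) in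
   characteristic 2; subtracting it clears the diagonal. *)
Definition normalize q (f : cocycle q) : cocycle q :=
  let h x y := f (x, y) (+) f (x, 0) (+) f (0, y) (+) f (0, 0) in
  let d x := h (x / 2%:R) (x / 2%:R) in
  [ffun z => h z.1 z.2 (+) d z.1 (+) d z.2 (+) d (z.1 + z.2)].

Lemma normalize_equiv q (f : cocycle q) : cocycle_equiv f (normalize f).
Proof.
pose h x y := f (x, y) (+) f (x, 0) (+) f (0, y) (+) f (0, 0).
pose d x := h (x / 2%:R) (x / 2%:R).
exists (fun x => f (x, 0) (+) d x), (fun y => f (0, y) (+) f (0, 0) (+) d y), d => x y.
have -> : normalize f (x, y) = h x y (+) d x (+) d y (+) d (x + y) by rewrite ffunE.
rewrite {1}/h; move: (d x) (d y) (d (x + y)) => dx dy dxy.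
case: (f (x, y)); case: (f (x, 0)); case: (f (0, y)); case: (f (0, 0));
  by case: dx; case: dy.
Qed.

Lemma normalize_normal q (f : cocycle q) : prime q -> odd q ->
  normalize f \in normal_cocycles q.
Proof.
move=> qp qo; apply/normal_cocycleP; split=> x; rewrite ffunE /=.
- rewrite addr0 mul0r.
  by case: (f (x, 0)); case: (f (0, 0)); case: (f _); case: (f _); case: (f _).
- rewrite add0r mul0r.
  by case: (f (0, x)); case: (f (0, 0)); case: (f _); case: (f _); case: (f _).
- rewrite mulrDl Fp_halfD // addbK.
  by case: (f _); case: (f _); case: (f _); case: (f _).
Qed.

Lemma normalizeP q (f g : cocycle q) : prime q -> odd q ->
  g \in normal_cocycles q -> normalize f = g <-> cocycle_equiv f g.
Proof.
move=> qp qo gN; split=> [<-|fg]; first exact: normalize_equiv.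
apply: cocycle_equiv_normal => //; first exact: normalize_normal.
exact: cocycle_equiv_trans (cocycle_equiv_sym (normalize_equiv f)) fg.
Qed.

Lemma normalize_eqP q (f g : cocycle q) : prime q -> odd q ->
  normalize f = normalize g <-> cocycle_equiv f g.
Proof.
move=> qp qo; rewrite normalizeP ?normalize_normal //; split=> fg.
  exact: cocycle_equiv_trans fg (cocycle_equiv_sym (normalize_equiv g)).
exact: cocycle_equiv_trans fg (normalize_equiv g).
Qed.

Lemma normalize_id q (f : cocycle q) : prime q -> odd q ->
  f \in normal_cocycles q -> normalize f = f.
Proof. by move=> qp qo fN; apply/normalizeP => //; apply: cocycle_equiv_refl. Qed.

(** * Transfer to multiplication tables *)

Lemma isomorphic_table (T : finType) (op : T -> T -> T) n : #|T| = n ->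
  exists t : mul_table n, loop_isomorphic op (table_op t).
Proof.
move=> <-; exists [ffun z => enum_rank (op (enum_val z.1) (enum_val z.2))].
exists enum_rank; first exact: enum_rank_bij.
by move=> x y; rewrite /table_op ffunE /= !enum_rankK.
Qed.

(** The relation [E] is left abstract so that isomorphism and isotopy are treated at once. *)
Lemma card_nilpotent_classes q
    (E : forall T1 T2 : Type, (T1 -> T1 -> T1) -> (T2 -> T2 -> T2) -> Prop) :
  prime q -> odd q ->
  (forall T1 T2 op1 op2, E T1 T2 op1 op2 -> E T2 T1 op2 op1) ->
  (forall T1 T2 T3 op1 op2 op3, E T1 T2 op1 op2 -> E T2 T3 op2 op3 -> E T1 T3 op1 op3) ->
  (forall T1 T2 op1 op2, loop_isomorphic op1 op2 -> E T1 T2 op1 op2) ->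
  #|equivalence_partition
     (fun f g : cocycle q => `[< E _ _ (cocycle_mul f) (cocycle_mul g) >])
     (normal_cocycles q)| =
  #|equivalence_partition
     (fun s t : mul_table (2 * q) => `[< E _ _ (table_op s) (table_op t) >])
     (nilpotent_loops (2 * q))|.
Proof.
move=> qp qo Es Et Ei.
have cardF : #|{: bool * 'F_q}| = (2 * q)%N by rewrite card_prod card_bool card_Fp.
have [h hP] := choice (fun f : cocycle q => isomorphic_table (cocycle_mul f) cardF).
apply: (@card_equivalence_partition_transfer _ _ _ _ _ _ h).
- move=> s t r _ _ _; split; first by apply/asboolP/Ei/loop_isomorphic_refl.
  move=> /asboolP st; apply/asboolP/asboolP => H; last exact: Et st H.
  exact: Et (Es _ _ _ _ st) H.
- move=> f fN; rewrite inE; apply/asboolP.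
  apply: (nilpotent_isomorphic (hP f)); first exact: cocycle_mul_loop.
  exact: cocycle_mul_nilpotent.
- move=> f g fN gN; apply/asboolP/asboolP => H.
    apply: (Et _ _ _ _ _ _ (Es _ _ _ _ (Ei _ _ _ _ (hP f)))); apply: (Et _ _ _ _ _ _ H).
    exact: Ei.
  apply: (Et _ _ _ _ _ _ (Ei _ _ _ _ (hP f))); apply: (Et _ _ _ _ _ _ H).
  exact/Es/Ei.
- move=> t; rewrite inE => /asboolP[L nil].
  have [f fN fi] := nilpotent_loop_cocycle qp qo (card_ord _) L nil.
  exists f => //; apply/asboolP; apply: (Et _ _ _ _ _ _ (Es _ _ _ _ (Ei _ _ _ _ fi))).
  exact: Ei.
Qed.

Lemma isomorphic_isotopic (T1 T2 : Type) (op1 : T1 -> T1 -> T1)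
    (op2 : T2 -> T2 -> T2) : loop_isomorphic op1 op2 -> isotopic op1 op2.
Proof. by move=> [f bf M]; exists f, f, f; split=> // x y; rewrite M. Qed.

(** * Group actions on normal cocycles and Burnside counts *)

Definition scaling_action q (u : {unit 'F_q}) (f : cocycle q) :=
  cocycle_pull f (val u) 0 0.

(** A translation can destroy the normal form, so the pullback is normalized again. *)
Definition affine_action q (g : {unit 'F_q} * ('F_q * 'F_q)) (f : cocycle q) :=
  normalize (cocycle_pull f (val g.1) g.2.1 g.2.2).

(** The composite affine map with [g] applied first, since pulling back reverses composition. *)
Definition affine_mul q (g h : {unit 'F_q} * ('F_q * 'F_q)) :
  {unit 'F_q} * ('F_q * 'F_q) :=
  ((h.1 * g.1)%g, (val h.1 * g.2.1 + h.2.1, val h.1 * g.2.2 + h.2.2)).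

Lemma cocycle_pullM q (f : cocycle q) u s t u' s' t' :
  cocycle_pull (cocycle_pull f u s t) u' s' t' =
  cocycle_pull f (u * u') (u * s' + s) (u * t' + t).
Proof.
by apply/ffunP => z; rewrite !ffunE /scaled_shift /=; congr (f (_, _)); ring.
Qed.

Lemma unit_neq0 q (u : {unit 'F_q}) : val u != 0 :> 'F_q.
Proof. by rewrite -unitfE; apply: valP. Qed.

Lemma exists_unit q (u : 'F_q) : u != 0 -> exists v : {unit 'F_q}, val v = u.
Proof. by rewrite -unitfE => uU; exists (FinRing.unit 'F_q uU). Qed.

Lemma affine_mulI q (h : {unit 'F_q} * ('F_q * 'F_q)) : injective (@affine_mul q ^~ h).
Proof.
move=> [u [s t]] [u' [s' t']] E.
have /mulgI /= -> := congr1 fst E.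
have /addIr/(mulfI (unit_neq0 _)) /= -> := congr1 (fst \o snd) E.
by have /addIr/(mulfI (unit_neq0 _)) /= -> := congr1 (snd \o snd) E.
Qed.

Section Counting.

Variables (q : nat) (qp : prime q) (qo : odd q).

Lemma affine_action_normal g (f : cocycle q) : affine_action g f \in normal_cocycles q.
Proof. exact: normalize_normal. Qed.

Lemma affine_actionM g h (f : cocycle q) :
  affine_action g (affine_action h f) = affine_action (affine_mul g h) f.
Proof.
apply/normalize_eqP => //; rewrite /affine_mul /= -cocycle_pullM.
by apply/cocycle_equiv_pull/cocycle_equiv_sym/normalize_equiv.
Qed.

Lemma affine_action_scaling u (f : cocycle q) : f \in normal_cocycles q ->
  affine_action (u, (0, 0)) f = scaling_action u f.
Proof.
by move=> fN; apply: normalize_id => //; apply: cocycle_pull_normal.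
Qed.

Lemma num_iso_burnside :
  (num_nilpotent_iso (2 * q) * #|{: {unit 'F_q}}| =
   \sum_u #|[set f in normal_cocycles q | scaling_action u f == f]|)%N.
Proof.
rewrite /num_nilpotent_iso -(card_nilpotent_classes qp qo loop_isomorphic_sym
  loop_isomorphic_trans (fun _ _ _ _ => id)).
apply: (@orbit_counting _ _ _ _ (fun u v => (v * u)%g)).
- by move=> h; apply: mulgI.
- by move=> f fN u; apply: cocycle_pull_normal.
- by move=> f fN u v; rewrite /scaling_action cocycle_pullM !mulr0 !addr0.
- move=> f g h _ _ _; split; first by apply/asboolP/loop_isomorphic_refl.
  move=> /asboolP fg; apply/asboolP/asboolP; last exact: loop_isomorphic_trans.
  exact/loop_isomorphic_trans/loop_isomorphic_sym.
move=> f g fN gN; apply/asboolP/existsP => [/loop_isomorphic_sym|[u /eqP uE]].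
  move=> /(isomorphic_cocycleP qp qo gN fN)[u [/exists_unit[v <-] E]].
  by exists v; apply/eqP.
apply/loop_isomorphic_sym/(isomorphic_cocycleP qp qo gN fN).
by exists (val u); split=> //; apply: unit_neq0.
Qed.

Lemma num_isotopy_burnside :
  (num_nilpotent_isotopy (2 * q) * #|{: {unit 'F_q} * ('F_q * 'F_q)}| =
   \sum_g #|[set f in normal_cocycles q | affine_action g f == f]|)%N.
Proof.
rewrite /num_nilpotent_isotopy -(card_nilpotent_classes qp qo isotopic_sym
  isotopic_trans isomorphic_isotopic).
apply: (@orbit_counting _ _ _ _ (@affine_mul q)).
- by move=> h; apply: affine_mulI.
- by move=> f fN g; apply: affine_action_normal.
- by move=> f fN g h; apply: affine_actionM.
- move=> f g h _ _ _; split; first by apply/asboolP/isotopic_refl.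
  move=> /asboolP fg; apply/asboolP/asboolP; last exact: isotopic_trans.
  exact/isotopic_trans/isotopic_sym.
move=> f g fN gN; apply/asboolP/existsP => [/isotopic_sym|[u /eqP uE]].
  move=> /(isotopic_cocycleP g qp qo fN)[u [s [t [/exists_unit[v <-] E]]]].
  exists (v, (s, t)); apply/eqP/normalizeP => //.
  exact: cocycle_equiv_sym.
apply/isotopic_sym/(isotopic_cocycleP g qp qo fN).
exists (val u.1), u.2.1, u.2.2; split; first exact: unit_neq0.
by apply/cocycle_equiv_sym/normalizeP.
Qed.

End Counting.

(** * Fixed points *)

Lemma card_Fp_unit q : prime q -> #|{: {unit 'F_q}}| = (q - 1)%N.
Proof. by move=> qp; rewrite -cardsT card_finField_unit card_Fp // subn1. Qed.

Lemma card_free_pairs q : prime q -> #|free_pairs q| = ((q - 1) * (q - 2))%N.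
Proof.
move=> qp; have q1 := prime_gt1 qp.
pose A : {set 'F_q} := [set~ 0].
have cA : #|A| = (q - 1)%N by rewrite cardsC1 card_Fp // subn1.
have -> : free_pairs q = setX A A :\: [set (x, x) | x in A].
  apply/setP => -[x y]; rewrite !inE /=.
  have -> : ((x, y) \in [set (z, z) | z in A]) = (x != 0) && (x == y).
    apply/imsetP/andP => [[z]|[x0 /eqP <-]]; last by exists x; rewrite ?inE.
    by rewrite !inE => z0 [-> ->].
  by case: (x == 0); case: (y == 0); case: (x == y).
have dI : injective (fun x : 'F_q => (x, x)) by move=> x y [].
rewrite cardsD (setIidPr _).
  by rewrite cardsX card_imset // cA; nia.
by apply/subsetP => _ /imsetP[x xA ->]; rewrite inE /= xA.
Qed.

Definition scale_pair q (u : {unit 'F_q}) (z : 'F_q * 'F_q) := (val u * z.1, val u * z.2).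

Lemma scale_pairI q (u : {unit 'F_q}) : injective (scale_pair u).
Proof.
move=> [x y] [x' y'] E.
have /(mulfI (unit_neq0 u)) /= -> := congr1 fst E.
by have /(mulfI (unit_neq0 u)) /= -> := congr1 snd E.
Qed.

(** The powers of [u] act freely on pairs with nonzero first coordinate. *)
Lemma card_scale_porbit q (u : {unit 'F_q}) (z : 'F_q * 'F_q) : z.1 != 0 ->
  #|porbit (perm (@scale_pairI q u)) z| = #[u]%g.
Proof.
move=> z0; set p := perm _.
have pX i : (p ^+ i)%g z = scale_pair (u ^+ i)%g z.
  elim: i => [|i IH]; first by rewrite perm1 /scale_pair /= !mul1r; case: (z).
  by rewrite expgSr permM IH permE expgS /scale_pair /= !mulrA.
have sI : injective (fun w : {unit 'F_q} => scale_pair w z).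
  by move=> w w' /(congr1 fst)/= /(mulIf z0)/val_inj.
rewrite /order -(card_imset _ sI); apply: eq_card => y.
apply/porbitP/imsetP => [[i ->]|[w /cycleP[i ->] ->]].
  by exists (u ^+ i)%g; rewrite ?mem_cycle.
by exists i.
Qed.

Section FixedPoints.

Variables (q : nat) (qp : prime q) (qo : odd q).

(** Fixed cocycles are predicates on the (q-1)(q-2) free pairs that are constant on the orbits of
    [u], all of which have size the order of [u]. *)
Lemma card_fix_scaling (u : {unit 'F_q}) :
  #|[set f in normal_cocycles q | scaling_action u f == f]| =
  (2 ^ ((q - 2) * ((q - 1) %/ #[u]%g)))%N.
Proof.
pose p := perm (@scale_pairI q u).
have pY : {in free_pairs q, forall z, p z \in free_pairs q}.
  move=> z; rewrite !inE permE /= => /and3P[z1 z2 z12].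
  by rewrite !mulf_neq0 ?unit_neq0 // (inj_eq (mulfI (unit_neq0 u))).
have dvu : (#[u]%g %| q - 1)%N.
  by rewrite -card_Fp_unit // -cardsT order_dvdG ?inE.
have := @card_uniform_porbits _ p (free_pairs q) #[u]%g pY.
rewrite card_free_pairs // => cE.
have {}cE : ((q - 1) * (q - 2) = #|porbit p @: free_pairs q| * #[u]%g)%N.
  by apply: cE => z; rewrite inE => /andP[z1 _]; apply: card_scale_porbit.
rewrite (_ : _ * _ = #|porbit p @: free_pairs q|)%N; last first.
  apply/eqP; rewrite -(eqn_pmul2r (order_gt0 u)) -cE -mulnA divnK //.
  by rewrite mulnC.
rewrite -(card_invariant_predicates pY); apply: eq_card => f; rewrite !inE.
congr (_ && _); apply/eqP/forallP => [/ffunP E z|E].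
  by have := E z; rewrite ffunE /scaled_shift !addr0 permE => /eqP.
by apply/ffunP => z; have := E z; rewrite ffunE /scaled_shift !addr0 permE => /eqP.
Qed.

(** Acting by [h] maps the fixed points of [g] injectively to those of its conjugate [g']. Two such
    inequalities give equality. *)
Lemma card_fix_conjugate (g g' h h' : {unit 'F_q} * ('F_q * 'F_q)) :
  affine_mul h' h = (1%g, (0, 0)) -> affine_mul g' h = affine_mul h g ->
  (#|[set f in normal_cocycles q | affine_action g f == f]| <=
   #|[set f in normal_cocycles q | affine_action g' f == f]|)%N.
Proof.
move=> h'h g'h.
have one (f : cocycle q) : f \in normal_cocycles q -> affine_action (1%g, (0, 0)) f = f.
  move=> fN; rewrite affine_action_scaling //; apply/ffunP => -[x y].
  by rewrite ffunE /scaled_shift /= !mul1r !addr0.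
rewrite -(@card_in_imset _ _ (affine_action h)); last first.
  move=> f f'; rewrite inE => /andP[fN _]; rewrite inE => /andP[f'N _] E.
  by rewrite -(one f) // -(one f') // -h'h -!affine_actionM // E.
apply/subset_leq_card/subsetP => _ /imsetP[f + ->].
rewrite inE => /andP[fN /eqP fE].
rewrite inE affine_action_normal //=.
by rewrite affine_actionM // g'h -affine_actionM // fE.
Qed.

(** For u <> 1 the map (x, y) |-> (ux + s, uy + t) has the fixed point ([s0], [t0]), and conjugating
    by the translation to it leaves a pure scaling. *)
Lemma card_fix_affine (u : {unit 'F_q}) s t : u != 1%g ->
  #|[set f in normal_cocycles q | affine_action (u, (s, t)) f == f]| =
  (2 ^ ((q - 2) * ((q - 1) %/ #[u]%g)))%N.
Proof.
move=> u1; rewrite -card_fix_scaling.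
have u1' : 1 - val u != 0 :> 'F_q.
  by rewrite subr_eq0 eq_sym; apply: contraNneq u1 => E; apply/eqP/val_inj.
transitivity #|[set f in normal_cocycles q | affine_action (u, (0, 0)) f == f]|; last first.
  apply: eq_card => f; rewrite inE [in RHS]inE.
  by case fN: (f \in normal_cocycles q) => //=; rewrite affine_action_scaling.
pose s0 := s / (1 - val u); pose t0 := t / (1 - val u).
have sE : val u * s0 + s = s0 by rewrite /s0; field.
have tE : val u * t0 + t = t0 by rewrite /t0; field.
apply/eqP; rewrite eqn_leq; apply/andP; split.
  apply: (@card_fix_conjugate _ _ (1%g, (s0, t0)) (1%g, (- s0, - t0))).
    by rewrite /affine_mul /= mulg1 !mul1r !addNr.
  by rewrite /affine_mul /= mulg1 mul1g !mul1r !add0r sE tE.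
apply: (@card_fix_conjugate _ _ (1%g, (- s0, - t0)) (1%g, (s0, t0))).
  by rewrite /affine_mul /= mulg1 !mul1r !addrN.
rewrite /affine_mul /= mulg1 mul1g !mul1r !mulrN !addr0; congr (_, (_, _)).
  by apply: (addrI (val u * s0)); rewrite addrA sE !subrr.
by apply: (addrI (val u * t0)); rewrite addrA tE !subrr.
Qed.

Lemma big_addb_const (b : bool) n : \big[addb/false]_(i < n) b = odd n && b.
Proof.
by elim: n => [|n IH]; rewrite ?big_ord0 // big_ord_recr IH /=; case: (odd n); case: (b).
Qed.

Lemma big_addb_Fp_const (b : bool) : \big[addb/false]_(i : 'F_q) b = b.
Proof. by have := big_addb_const b q; rewrite !big_const card_Fp // card_ord qo. Qed.

Lemma cocycle_equiv_add (f g f' g' : cocycle q) :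
  cocycle_equiv f g -> cocycle_equiv f' g' ->
  cocycle_equiv [ffun z => f z (+) f' z] [ffun z => g z (+) g' z].
Proof.
move=> [a [b [c E]]] [a' [b' [c' E']]].
exists (fun x => a x (+) a' x), (fun x => b x (+) b' x), (fun x => c x (+) c' x) => x y.
rewrite !ffunE E E'; case: (f _); case: (a _); case: (b _); case: (c _);
  by case: (f' _); case: (a' _); case: (b' _); case: (c' _).
Qed.

(* q being odd, summing over the q translates projects onto the invariants. *)
Lemma fix_translation s t :
  [set f in normal_cocycles q | affine_action (1%g, (s, t)) f == f] =
  @normalize q @: [set f | cocycle_pull f 1 s t == f].
Proof.
apply/setP => f; rewrite [LHS]inE; apply/andP/imsetP => [[fN /eqP fE]|[h + ->]]; last first.
  rewrite inE => /eqP hE; rewrite normalize_normal //; split=> //.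
  apply/eqP/normalize_eqP => //=; rewrite -[X in cocycle_equiv _ X]hE.
  exact/cocycle_equiv_pull/cocycle_equiv_sym/normalize_equiv.
have {}fE : cocycle_equiv f (cocycle_pull f 1 s t).
  by apply/cocycle_equiv_sym/normalizeP.
have fEn n : cocycle_equiv f (cocycle_pull f 1 (s *+ n) (t *+ n)).
  elim: n => [|n IH].
    rewrite (_ : cocycle_pull _ _ _ _ = f); first exact: cocycle_equiv_refl.
    by apply/ffunP => -[x y]; rewrite ffunE /scaled_shift /= !mul1r !addr0.
  rewrite (_ : cocycle_pull f 1 _ _ = cocycle_pull (cocycle_pull f 1 (s *+ n) (t *+ n)) 1 s t).
    exact/(cocycle_equiv_trans fE)/cocycle_equiv_pull.
  by rewrite cocycle_pullM !mul1r !mulrS.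
pose h n : cocycle q := [ffun z => \big[addb/false]_(i < n) f (z.1 + s *+ i, z.2 + t *+ i)].
(* A sum of n translates of f is equivalent to n copies of f, that is to f itself for n = q odd. *)
have hE n : cocycle_equiv [ffun z => odd n && f z] (h n).
  elim: n => [|n IH].
    rewrite (_ : h 0%N = [ffun z => odd 0 && f z]); first exact: cocycle_equiv_refl.
    by apply/ffunP => z; rewrite !ffunE big_ord0.
  have := cocycle_equiv_add IH (fEn n); congr cocycle_equiv; apply/ffunP => z; rewrite !ffunE.
    by rewrite /=; case: (odd n); case: (f z).
  by rewrite big_ord_recr /= /scaled_shift !mul1r.
exists (h q); last first.
  apply/esym/normalizeP => //; apply: cocycle_equiv_sym.
  by have := hE q; congr cocycle_equiv; apply/ffunP => z; rewrite ffunE qo.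
rewrite inE; apply/eqP/ffunP => z; rewrite !ffunE /scaled_shift /= !mul1r.
(* Translating [h q] shifts the summation index by one, and the new term at q equals the old term at
   0 because q s = q t = 0. *)
pose F i := f (z.1 + s *+ i, z.2 + t *+ i).
have sq x : x *+ q = 0 :> 'F_q by apply: mulrn_pchar; apply: pchar_Fp.
have Fq : F q = F 0%N by rewrite /F !sq.
have := big_ord_recr q (op := addb) (idx := false) F; rewrite big_ord_recl Fq /= addbC.
move/addIb => /= <-; apply: eq_bigr => i _.
by rewrite /F /= /bump /= !add1n !mulrS !addrA.
Qed.

Lemma invariant_translate (f : cocycle q) s t : cocycle_pull f 1 s t = f ->
  forall i x y, f (x + i * s, y + i * t) = f (x, y).
Proof.
move=> /ffunP fE i x y; rewrite -[i]natr_Zp; elim: (nat_of_ord i) => [|n <-].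
  by rewrite !mul0r !addr0.
have := fE (x + n%:R * s, y + n%:R * t); rewrite ffunE /scaled_shift /= !mul1r => <-.
by congr (f (_, _)); rewrite -natr1; ring.
Qed.

(** An invariant function depends only on x if s = 0, only on y if t = 0, and only on x + y if s + t
    = 0; in each case it is equivalent to zero. *)
Lemma card_fix_degenerate_translation s t : (s, t) != (0, 0) ->
  [|| s == 0, t == 0 | s + t == 0] ->
  #|[set f in normal_cocycles q | affine_action (1%g, (s, t)) f == f]| = 1%N.
Proof.
move=> st0 st; rewrite fix_translation.
rewrite (_ : _ @: _ = [set (normalize [ffun=> false])]) ?cards1 //.
apply/setP => f; rewrite in_set1; apply/imsetP/eqP => [[h + ->]|->]; last first.
  by exists [ffun=> false]; rewrite // inE; apply/eqP/ffunP => z; rewrite !ffunE.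
rewrite inE => /eqP /invariant_translate hE; apply/normalize_eqP => //.
apply: cocycle_equiv_sym.
case: (s =P 0) st0 st => [s0|/eqP s0] st0 st.
  have t0 : t != 0 by apply: contraNneq st0 => ->; rewrite s0.
  exists (fun x => h (x, 0)), (fun=> false), (fun=> false) => x y.
  by rewrite ffunE !addbF /= -(hE (y / t) x 0) s0 mulr0 addr0 add0r divfK.
case: (t =P 0) st => [t0 _|_ /= /eqP st].
  exists (fun=> false), (fun y => h (0, y)), (fun=> false) => x y.
  by rewrite ffunE !addbF /= -(hE (x / s) 0 y) t0 mulr0 addr0 add0r divfK.
exists (fun=> false), (fun=> false), (fun x => h (x, 0)) => x y.
have tE : t = - s by apply/eqP; rewrite -addr_eq0 addrC st.
rewrite ffunE /= -(hE (y / s) x y) tE mulrN divfK // subrr.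
by [].
Qed.

Lemma card_predicates_vanishing (T : finType) (x0 : T) :
  #|[set k : {ffun T -> bool} | ~~ k x0]| = (2 ^ #|T|.-1)%N.
Proof.
rewrite -card_bool -(cardC1 x0) -(card_pffun_on false); apply: eq_card => k.
rewrite inE; apply/idP/pffun_onP => [kx|[/subsetP sk _]].
  split=> //; apply/subsetP => x; rewrite !inE; apply: contraNneq => ->.
  by rewrite (negbTE kx).
by apply/negP => kx; have := sk x0; rewrite !inE kx eqxx => /(_ isT).
Qed.

Lemma big_addb_affine (a : 'F_q -> bool) (r v : 'F_q) : r != 0 ->
  \big[addb/false]_(i : 'F_q) a (v + i * r) = \big[addb/false]_(i : 'F_q) a i.
Proof.
move=> r0; rewrite [RHS](reindex (fun i => v + i * r)) //.
exists (fun i => (i - v) / r) => i _ /=; first by rewrite addrC addKr mulfK.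
by rewrite divfK // addrC subrK.
Qed.

(** Invariant functions have the form k (x - r y) with r = s / t. Constants are equivalent to zero,
    so k 0 = 0 may be imposed; the remaining k are pairwise inequivalent. *)
Lemma card_fix_generic_translation s t : s != 0 -> t != 0 -> s + t != 0 ->
  #|[set f in normal_cocycles q | affine_action (1%g, (s, t)) f == f]| =
  (2 ^ (q - 1))%N.
Proof.
move=> s0 t0 st0; rewrite fix_translation.
pose r := s / t.
have r0 : r != 0 by rewrite mulf_neq0 ?invr_eq0.
have r1 : r + 1 != 0.
  by apply: contraNneq st0 => E; rewrite -[s](divfK t0) -/r -{2}[t]mul1r -mulrDl E mul0r.
pose lift (k : {ffun 'F_q -> bool}) : cocycle q := [ffun z => k (z.1 - r * z.2)].
rewrite (_ : _ @: _ = (@normalize q \o lift) @: [set k : {ffun 'F_q -> bool} | ~~ k 0]).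
  rewrite card_in_imset ?card_predicates_vanishing ?card_Fp ?subn1 //.
  move=> k k'; rewrite !inE => k0 k'0 /normalize_eqP => /(_ qp qo)[a [b [c E]]].
  (* Sum the equivalence over the line x - r y = w. There x, y and x + y each run through F_q, as r
     and r + 1 are nonzero, so k and k' differ by a constant independent of w. *)
  have kE w : k' w = k w (+) (\big[addb/false]_(i : 'F_q) a i
      (+) \big[addb/false]_(i : 'F_q) b i (+) \big[addb/false]_(i : 'F_q) c i).
    rewrite -(big_addb_Fp_const (k w)) -(big_addb_Fp_const (k' w)).
    rewrite -(big_addb_affine a w r0) -(big_addb_affine b 0 (oner_neq0 _)).
    rewrite -(big_addb_affine c w r1) -!big_split /=; apply: eq_bigr => i _.
    have := E (w + i * r) (0 + i * 1); rewrite !ffunE /=.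
    have -> : w + i * r - r * (0 + i * 1) = w by ring.
    have -> : w + i * r + (0 + i * 1) = w + i * (r + 1) by ring.
    by rewrite !addbA.
  apply/ffunP => w; rewrite (kE w); have := kE 0; rewrite (negbTE k0) (negbTE k'0) /= => <-.
  by rewrite addbF.
apply/setP => f; apply/imsetP/imsetP => [[h + ->]|[k _ ->]].
  rewrite inE => /eqP /invariant_translate hE.
  exists [ffun x => h (x, 0) (+) h (0, 0)]; first by rewrite inE ffunE addbb.
  apply/normalize_eqP => //.
  exists (fun=> h (0, 0)), (fun=> false), (fun=> false) => x y.
  rewrite !ffunE /= !addbF; congr (_ (+) _).
  rewrite -(hE (- (y / t)) x y) !mulNr divfK // subrr; congr (h (_, _)).
  by rewrite /r; ring.
exists (lift k) => //; rewrite inE; apply/eqP/ffunP => z.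
rewrite !ffunE /scaled_shift /=; congr (k _); rewrite !mul1r /r.
by rewrite mulrDr divfK //; ring.
Qed.

End FixedPoints.

(** * Summing the fixed points and the final formula *)

(** In the cyclic group F_q^* of order n, the i-th power of a generator has order n / gcd(n, i). *)
Lemma sum_Fp_unit_order q (F : nat -> rat) : prime q ->
  \sum_(u : {unit 'F_q}) F ((q - 1) %/ #[u]%g)%N =
  \sum_(1 <= i < (q - 1).+1) F (gcdn (q - 1) i).
Proof.
move=> qp; set n := (q - 1)%N; have n0 : (0 < n)%N by rewrite subn_gt0 prime_gt1.
have /cyclicP[g gE] := field_unit_group_cyclic [set: {unit 'F_q}]%G.
have og : #[g]%g = n by rewrite /order -gE cardsT card_Fp_unit.
have gI : injective (fun i : 'I_n => (g ^+ i)%g).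
  move=> i j /eqP; rewrite eq_expg_mod_order og !modn_small // => /eqP.
  exact: val_inj.
have gB : bijective (fun i : 'I_n => (g ^+ i)%g).
  by apply: inj_card_bij => //; rewrite card_Fp_unit // card_ord.
have divKd d : (d %| n)%N -> (n %/ (n %/ d))%N = d.
  case/dvdnP => k kE; have [d0 k0] : (0 < d)%N /\ (0 < k)%N by nia.
  by rewrite kE mulnK // mulKn.
rewrite (reindex _ (onW_bij _ gB)) /=.
transitivity (\sum_(0 <= i < n) F (gcdn n i)).
  rewrite big_mkord; apply: eq_bigr => i _; rewrite orderXgcd og; congr F.
  exact/divKd/dvdn_gcdl.
(* The exponent 0 is traded for n, both having gcd n with n. *)
by rewrite [LHS]big_ltn // [RHS]big_nat_recr //= gcdnn gcdn0 addrC.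
Qed.

(** Each of the lines s = 0, t = 0 and s + t = 0 has q - 1 nonzero points; (q-1)(q-2) generic
    translations and the identity remain. *)
Lemma sum_fix_translations q : prime q -> odd q ->
  (\sum_(z : 'F_q * 'F_q)
     #|[set f in normal_cocycles q | affine_action (1%g, z) f == f]| =
   2 ^ ((q - 2) * (q - 1)) + 3 * (q - 1) + (q - 1) * (q - 2) * 2 ^ (q - 1))%N.
Proof.
move=> qp qo; have q2 : (2 < q)%N by rewrite odd_prime_gt2.
have cF : #|'F_q| = q by rewrite card_Fp.
have cF0 : #|[set~ (0 : 'F_q)]| = (q - 1)%N by rewrite cardsC1 cF subn1.
pose F s t := #|[set f in normal_cocycles q | affine_action (1%g, (s, t)) f == f]|.
have F00 : F 0 0 = (2 ^ ((q - 2) * (q - 1)))%N.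
  transitivity #|[set f in normal_cocycles q | scaling_action (1%g : {unit 'F_q}) f == f]|.
    apply: eq_card => f; rewrite inE [in RHS]inE.
    by case fN: (f \in normal_cocycles q) => //=; rewrite affine_action_scaling.
  by rewrite card_fix_scaling // order1 divn1.
transitivity (\sum_s \sum_t F s t)%N; first by rewrite pair_bigA; apply: eq_bigr => -[].
rewrite (bigD1 0) //= (bigD1 0) //= F00.
have -> : (\sum_(t : 'F_q | t != 0%R) F 0%R t = q - 1)%N.
  rewrite (eq_bigr (fun=> 1%N)); last first.
    move=> t t0; apply: card_fix_degenerate_translation; rewrite ?eqxx //.
  by rewrite sum1dep_card -cF0; apply: eq_card => x; rewrite !inE.
rewrite (eq_bigr (fun=> (2 + (q - 2) * 2 ^ (q - 1))%N)); last first.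
  move=> s s0; rewrite (bigD1 0) //= (bigD1 (- s)) ?oppr_eq0 //=.
  rewrite {1}/F card_fix_degenerate_translation ?eqxx ?orbT //; last first.
    by rewrite xpair_eqE negb_and s0.
  rewrite {1}/F card_fix_degenerate_translation ?subrr ?eqxx ?orbT //; last first.
    by rewrite xpair_eqE negb_and s0.
  rewrite addnA; congr (_ + _)%N.
  rewrite (eq_bigr (fun=> (2 ^ (q - 1))%N)); last first.
    move=> t /andP[t0 ts]; apply: card_fix_generic_translation => //.
    by rewrite addrC addr_eq0.
  rewrite sum_nat_const; congr (_ * _)%N.
  have <- : #|[set~ (0 : 'F_q)] :\ (- s)| = (q - 2)%N.
    have sN : - s \in [set~ (0 : 'F_q)] by rewrite !inE oppr_eq0.
    have := cardsD1 (- s) [set~ (0 : 'F_q)]; rewrite cF0 sN add1n => E.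
    by rewrite -[LHS]succnK -E; lia.
  by apply: eq_card => t; rewrite !inE andbC.
rewrite sum_nat_const.
rewrite (eq_card (B := mem [set~ (0 : 'F_q)])) ?cF0; last by move=> x; rewrite !inE.
lia.
Qed.

(** The extra term on the left is the u = 1 summand of the last sum on the right; adding it avoids
    subtraction of natural numbers. *)
Lemma sum_fix_affine q : prime q -> odd q ->
  (\sum_(g : {unit 'F_q} * ('F_q * 'F_q))
     #|[set f in normal_cocycles q | affine_action g f == f]| +
     q * q * 2 ^ ((q - 2) * (q - 1)) =
   2 ^ ((q - 2) * (q - 1)) + 3 * (q - 1) + (q - 1) * (q - 2) * 2 ^ (q - 1) +
     q * q * \sum_(u : {unit 'F_q}) 2 ^ ((q - 2) * ((q - 1) %/ #[u]%g)))%N.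
Proof.
move=> qp qo; rewrite -sum_fix_translations //.
set Tr := (\sum_(z : 'F_q * 'F_q) _)%N.
pose F u z := #|[set f in normal_cocycles q | affine_action (u, z) f == f]|.
have -> : (\sum_g #|[set f in normal_cocycles q | affine_action g f == f]| =
    \sum_(u : {unit 'F_q}) \sum_z F u z)%N.
  by rewrite pair_bigA; apply: eq_bigr => -[].
rewrite (bigD1 1%g) //= [in RHS](bigD1 1%g) //= order1 divn1 mulnDr.
rewrite (eq_bigr (fun u : {unit 'F_q} => q * q * 2 ^ ((q - 2) * ((q - 1) %/ #[u]%g)))%N).
  by rewrite -big_distrr /= addnAC -!addnA.
move=> u u1; rewrite (eq_bigr (fun=> (2 ^ ((q - 2) * ((q - 1) %/ #[u]%g)))%N)).
  by rewrite sum_nat_const card_prod card_Fp.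
by move=> [s t] _; apply: card_fix_affine.
Qed.

Theorem theorem6p10 (q : nat) (q_prime : prime q) (q_odd : odd q) :
  ((num_nilpotent_isotopy (2 * q)%N)%:R : rat) =
      2 ^+ ((q - 2) * (q - 1)) / (q%:R ^+ 2 * (q%:R - 1))
    + (q%:R - 1)^-1 *
        (\sum_(D : {set 'I_(q - 1)} | (D != set0) && (D \subset Pred (q - 1)))
           (-1) ^+ #|D| * 2 ^+ ((q - 2) * gcd_set D))
    + \sum_(1 <= d < q - 1 | (d %| q - 1)%N)
        d%:R^-1 *
        (2 ^+ ((q - 2) * d)
         + \sum_(D : {set 'I_d} | (D != set0) && (D \subset Pred d))
             (-1) ^+ #|D| * 2 ^+ ((q - 2) * gcd_set D))
    + (q%:R ^+ 2)^-1 * ((q%:R - 2) * 2 ^+ (q - 1) + 3)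
  /\
  ((num_nilpotent_isotopy (2 * q)%N)%:R : rat) =
      (num_nilpotent_iso (2 * q)%N)%:R
    + (q%:R ^+ 2)^-1 *
        (- (q%:R + 1) * 2 ^+ ((q - 2) * (q - 1))
         + (q%:R - 2) * 2 ^+ (q - 1) + 3).
Proof.
have q2 : (2 < q)%N by rewrite odd_prime_gt2.
have n0 : (0 < q - 1)%N by rewrite subn_gt0 prime_gt1.
have nE : (q - 1)%:R = q%:R - 1 :> rat by rewrite natrB // prime_gt0.
have mE : (q - 2)%:R = q%:R - 2 :> rat by rewrite natrB // ltnW.
have q0R : q%:R != 0 :> rat by rewrite pnatr_eq0 -lt0n prime_gt0.
have n0R : q%:R - 1 != 0 :> rat by rewrite -nE pnatr_eq0 -lt0n.
(* [W] totals the fixed points of all scalings; both class numbers are expressed through it. *)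
pose W : rat := \sum_(u : {unit 'F_q}) 2 ^+ ((q - 2) * ((q - 1) %/ #[u]%g)).
set X : rat := 2 ^+ ((q - 2) * (q - 1)).
set Y : rat := 2 ^+ (q - 1).
have isoE : (num_nilpotent_iso (2 * q))%:R = W / (q%:R - 1).
  apply: (canRL (mulfK n0R)); rewrite -nE -natrM -card_Fp_unit // num_iso_burnside //.
  rewrite natr_sum; apply: eq_bigr => u _.
  by rewrite card_fix_scaling // natrX.
have isotE : (num_nilpotent_isotopy (2 * q))%:R =
    (X + 3 * (q%:R - 1) + (q%:R - 1) * (q%:R - 2) * Y + q%:R ^+ 2 * (W - X))
      / (q%:R ^+ 2 * (q%:R - 1)).
  have D0 : q%:R ^+ 2 * (q%:R - 1) != 0 :> rat by rewrite mulf_neq0 ?expf_neq0.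
  apply: (canRL (mulfK D0)).
  have cG : #|{: {unit 'F_q} * ('F_q * 'F_q)}| = ((q - 1) * (q * q))%N.
    by rewrite !card_prod card_Fp_unit // card_Fp.
  have := congr1 (fun n => n%:R : rat) (num_isotopy_burnside q_prime q_odd).
  have := congr1 (fun n => n%:R : rat) (sum_fix_affine q_prime q_odd).
  have WN : (\sum_(u : {unit 'F_q}) 2 ^ ((q - 2) * ((q - 1) %/ #[u]%g)))%N%:R = W.
    by rewrite natr_sum; apply: eq_bigr => u _; rewrite natrX.
  rewrite /= cG !natrD !natrM WN !natrX nE mE.
  rewrite -/X -/Y => E E'.
  have <- : (num_nilpotent_isotopy (2 * q))%:R * ((q%:R - 1) * (q%:R * q%:R)) =
    (num_nilpotent_isotopy (2 * q))%:R * (q%:R ^+ 2 * (q%:R - 1)) :> rat by ring.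
  rewrite E'; apply: (addIr (q%:R * q%:R * X)); rewrite E; ring.
(* Rewrites W / (q-1) as a sum over the divisors of q - 1, from which the summand d = q - 1 is then
   split off as in the stated formula. *)
have WE := sum_gcdn_divisors (fun m => 2 ^+ ((q - 2) * m)) n0.
rewrite -(sum_Fp_unit_order (fun m => 2 ^+ ((q - 2) * m)) q_prime) -/W in WE.
rewrite big_mkcond big_nat_recr //= dvdnn -big_mkcond /= nE -/X in WE.
(* In the second equality [W] cancels between the two Burnside counts. *)
split; last by rewrite isotE isoE; field; rewrite n0R q0R.
move: WE; set A := \sum_(1 <= d < q - 1 | _) _.
set B := \sum_(D : {set 'I_(q - 1)} | _) _ => WE.
have -> : A = (q%:R - 1)^-1 * W - (q%:R - 1)^-1 * (X + B) by rewrite WE addrK.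
by rewrite isotE; field; rewrite n0R q0R.
Qed.
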